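(* Let $S$ be a closed, connected, oriented surface of genus $g\ge 1$, let $\gamma\colon S^1\to S$ be a simple closed curve in $S$, and let $f\colon S\to S$ be the Dehn twist along $\gamma$. Then $\mathrm{FV}_{\mathbb{Z}}(f)=0$.
   Context: For a singular chain $c=\sum_k a_k\sigma_k$ with integer coefficients written in reduced form (distinct singular simplices $\sigma_k$), $\|c\|_1=\sum_k|a_k|$. For a boundary $z\in B_n(M,\mathbb{Z})$ in a manifold $M$, the filling norm is $\|z\|_{\mathrm{fill},\mathbb{Z}}=\inf\{\|b\|_1 : b\in C_{n+1}(M,\mathbb{Z}),\ \partial b=z\}$. Integral filling volume: for an orientation-preserving self-homeomorphism $f$ of a closed, connected, oriented $n$-manifold $M$ and a singular cycle $z\in C_n(M,\mathbb{Z})$ representing the fundamental class $[M]_{\mathbb{Z}}\in H_n(M,\mathbb{Z})$, $$\mathrm{FV}_{\mathbb{Z}}(f)=\lim_{m\to\infty}\frac{\|f^m_*(z)-z\|_{\mathrm{fill},\mathbb{Z}}}{m},$$ where $f_*$ is the map induced by $f$ on singular chains. It is known that this limit exists, is finite, does not depend on the choice of $z$, and depends only on the homotopy class of $f$. *)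

(* Defs.v *)
From HB Require Import structures.
From mathcomp Require Import all_boot all_order all_algebra.
From mathcomp.multinomials Require Import freeg.
From mathcomp Require Import all_classical all_reals all_analysis.

Set Implicit Arguments.
Unset Strict Implicit.
Unset Printing Implicit Defensive.

Import Order.TTheory GRing.Theory Num.Theory numFieldNormedType.Exports.

Local Open Scope classical_set_scope.
Local Open Scope ring_scope.

Section Simplex.
Context (R : realType).

Definition simplex_set (n : nat) : set 'rV[R]_n.+1 :=
  [set x | (forall i, 0 <= x 0 i) /\ \sum_i x 0 i = 1].
#[global] Arguments simplex_set n : clear implicits.

Definition simplex (n : nat) : topologicalType := set_type (simplex_set n).

(* The affine inclusion of the face opposite to the i-th vertex: insert a zero
   barycentric coordinate in position i. *)
Definition face_vec n (i : 'I_n.+2) (x : 'rV[R]_n.+1) : 'rV[R]_n.+2 :=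
  \row_j oapp (x 0) 0 (unlift i j).

Lemma face_vec_simplex n (i : 'I_n.+2) (x : simplex n) :
  face_vec i (val x) \in simplex_set n.+1.
Proof.
have [x0 x1] := set_valP x; apply/mem_set; split=> [j|].
  by rewrite mxE; case: unliftP => //= k _; exact: x0.
rewrite (bigD1_ord i)//= mxE unlift_none add0r -[RHS]x1.
by apply: eq_bigr => j _; rewrite mxE liftK.
Qed.

Definition face_fun n (i : 'I_n.+2) (x : simplex n) : simplex n.+1 :=
  exist _ (face_vec i (val x)) (face_vec_simplex i x).

Lemma continuous_face_vec n (i : 'I_n.+2) : continuous (@face_vec n i).
Proof.
move=> x U [P Pnbhs PU]; rewrite nbhs_simpl.
exists (fun _ b => P 0 (fintype.lift i b)) => [a b|y Py].
  by have := Pnbhs 0 (fintype.lift i b); rewrite (ord1 a) mxE liftK.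
apply: PU => a j; rewrite mxE (ord1 a); case: unliftP => [b ->|->] /=.
  exact: Py.
by have := Pnbhs 0 i; rewrite mxE unlift_none; exact: nbhs_singleton.
Qed.

Lemma continuous_face_fun n (i : 'I_n.+2) : continuous (@face_fun n i).
Proof.
apply: continuous_comp_initial => x.
apply: (@continuous_comp _ _ _ (set_val : simplex n -> _) (face_vec i)).
  exact: initial_continuous.
exact: continuous_face_vec.
Qed.

Definition face n (i : 'I_n.+2) : continuousType (simplex n) (simplex n.+1) :=
  mkcts (@continuous_face_fun n i).

End Simplex.
Arguments simplex R n : clear implicits.

Section Chains.
Context (R : realType) (S : topologicalType).

Definition sing (n : nat) := continuousType (simplex R n) S.

Definition chain (n : nat) := {freeg (sing n) / int}.

Definition boundary n (c : chain n.+1) : chain n :=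
  fglift (fun s : sing n.+1 =>
    \sum_(i < n.+2) [freeg [:: ((-1) ^+ i, s \o face R i : sing n)]]) c.

(* [dom c] lists each simplex with nonzero coefficient exactly once, i.e. it
   gives the reduced form of c. *)
Definition norm1 n (c : chain n) : nat :=
  (\sum_(s <- dom c) `|coeff s c|)%N.

(* The infimum is taken in the extended reals: it is +oo when z is not a
   boundary. *)
Definition filling_norm n (z : chain n) : \bar R :=
  ereal_inf [set ((norm1 b)%:R : R)%:E | b in [set b | boundary b = z]].

Definition push n (f : continuousType S S) (c : chain n) : chain n :=
  fglift (fun s : sing n => [freeg [:: (1, f \o s : sing n)]]) c.

Definition chain_in n (A : set S) (c : chain n) : Prop :=
  forall s : sing n, s \in dom c -> range s `<=` A.

Definition rel_cycle n (A : set S) (c : chain n.+1) : Prop :=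
  chain_in A (boundary c).

Definition rel_homologous n (A : set S) (c c' : chain n) : Prop :=
  exists b : chain n.+1, chain_in A (c - c' - boundary b).

End Chains.

Lemma continuous_iter (S : topologicalType) (f : continuousType S S) m :
  continuous (iter m f).
Proof.
elim: m => [|m IHm] x /=; first exact: cvg_id.
by apply: continuous_comp; [exact: IHm|exact: cts_fun].
Qed.

Definition homeomorphism (X Y : topologicalType) (h : X -> Y) : Prop :=
  continuous h /\ exists k, [/\ continuous k, cancel h k & cancel k h].

(* The last clause says that x has an open neighbourhood homeomorphic to R^n,
   so the manifold has no boundary. *)
Definition closed_manifold (R : realType) (n : nat) (M : topologicalType) :=
  [/\ hausdorff_space M, @second_countable M, compact [set: M] &
    forall x : M, exists h : 'rV[R]_n -> M,
      [/\ continuous h, injective h, forall U, open U -> open (h @` U) &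
          range h x]].

(* Orientation of a manifold M of dimension n.+1: a locally consistent choice
   of generators of the local homology groups H_(n+1)(M, M \ {x}), which are
   infinite cyclic. Each class is given by a relative cycle representing it. *)
Record orientation (R : realType) (n : nat) (M : topologicalType) := Orientation {
  local_cycle : M -> chain R M n.+1;
  local_cycleP : forall x, rel_cycle (~` [set x]) (local_cycle x);
  local_generator : forall x (c : chain R M n.+1), rel_cycle (~` [set x]) c ->
    exists k : int, rel_homologous (~` [set x]) c (k *: local_cycle x);
  locally_consistent : forall x, exists U : set M, [/\ open U, U x &
    exists c : chain R M n.+1, rel_cycle (~` U) c /\
      forall y, U y -> rel_homologous (~` [set y]) c (local_cycle y)]
}.

(* z represents the fundamental class, i.e. the class in H_(n+1)(M) restricting
   to the chosen generator at every point. *)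
Definition fundamental_cycle R n M (o : orientation R n M)
    (z : chain R M n.+1) : Prop :=
  boundary z = 0 /\
  forall x, rel_homologous (~` [set x]) z (local_cycle o x).

Definition iterate (M : topologicalType) (f : continuousType M M) m :
  continuousType M M := mkcts (@continuous_iter M f m).

(* FV(f) = v: for every fundamental cycle z the limit exists and equals v. *)
Definition integral_filling_volume_eq R n M (o : orientation R n M)
    (f : continuousType M M) (v : R) : Prop :=
  forall z : chain R M n.+1, fundamental_cycle o z ->
    ((m%:R^-1)%:E * filling_norm (push (iterate f m) z - z)%R)%E
      @[m --> \oo] --> v%:E.

Section Surfaces.
Context (R : realType) (S : topologicalType).

Definition circle : topologicalType :=
  set_type [set p : R * R | p.1 ^+ 2 + p.2 ^+ 2 = 1].

Lemma cis_circle (t : R) :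
  (cos t, sin t) \in [set p : R * R | p.1 ^+ 2 + p.2 ^+ 2 = 1].
Proof. by apply/mem_set; exact: cos2Dsin2. Qed.

Definition cis (t : R) : circle := exist _ (cos t, sin t) (cis_circle t).

Definition unit_interval : topologicalType := set_type `[0 : R, 1].

Definition simple_closed_curve (gamma : circle -> S) : Prop :=
  continuous gamma /\ injective gamma.

Definition nonseparating_system (k : nat) : Prop :=
  exists c : 'I_k -> circle -> S,
    [/\ forall i, simple_closed_curve (c i),
        forall i j, i != j -> range (c i) `&` range (c j) = set0 &
        connected (~` \bigcup_i range (c i))].

(* The maximal number of disjoint simple closed curves with connected
   complement. *)
Definition has_genus (g : nat) : Prop :=
  nonseparating_system g /\
  forall k, nonseparating_system k -> (k <= g)%N.

(* A closed annulus with core gamma. For a surface without boundary the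
   openness of the open annulus is automatic (invariance of domain). *)
Definition annular_neighbourhood (gamma : circle -> S)
    (phi : circle * unit_interval -> S) : Prop :=
  [/\ continuous phi, injective phi,
      open (phi @` [set p | 0 < val p.2 < 1]) &
      forall x t, val t = 2^-1 -> phi (x, t) = gamma x].

(* The annulus may be embedded with either orientation, so both the left and
   the right twists are covered. *)
Definition twist_map (gamma : circle -> S) (T : S -> S) : Prop :=
  exists phi, [/\ annular_neighbourhood gamma phi,
    forall a t, T (phi (cis a, t)) = phi (cis (a + 2 * pi * val t), t) &
    forall y, ~ range phi y -> T y = y].

Definition isotopic (f0 f1 : S -> S) : Prop :=
  exists H : unit_interval * S -> S,
    [/\ continuous H, forall t, homeomorphism (fun x => H (t, x)),
        forall t x, val t = 0 -> H (t, x) = f0 x &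
        forall t x, val t = 1 -> H (t, x) = f1 x].

(* The Dehn twist along gamma is well defined only up to isotopy. *)
Definition dehn_twist (gamma : circle -> S) (f : S -> S) : Prop :=
  exists T, twist_map gamma T /\ isotopic T f.

End Surfaces.

(* Main.v *)
Require Import Defs.
From HB Require Import structures.
From mathcomp Require Import all_boot all_order all_algebra.
From mathcomp.multinomials Require Import freeg.
From mathcomp Require Import all_classical all_reals all_analysis.
From mathcomp Require Import ring lra zify.

Set Implicit Arguments.
Unset Strict Implicit.
Unset Printing Implicit Defensive.

Import Order.TTheory GRing.Theory Num.Theory numFieldNormedType.Exports.

Local Open Scope classical_set_scope.
Local Open Scope ring_scope.

(* Up to homotopy, f^m twists only inside a slightly smaller annulus, where it
   adds m turns. After subdividing a cycle z, each simplex is either fixed by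
   this twist or small and contained in the open annulus. In the second case it
   lifts to the universal cover and can be straightened to a simplex [p|q] of
   the bar complex of Z = pi_1(annulus); the twist replaces it by
   [p + m al | q + m be]. All the homotopies cost a bounded number of simplices
   per simplex of z.

   [.|.] is a 2-cocycle up to boundaries of single 3-simplices. Applied to the
   central extension of Z^2 that it defines via (p, al) |-> p + m al, this shows
   that [p + m al | q + m be] is, up to bounded cost, a coboundary of terms
   attached to the edges plus al q times the commutator
   S(m, 1) = [m|1] - [1|m]. The edge terms cancel because z is a cycle.

   Finally S(m, 1) has a filling with O(sqrt m) simplices: S is biadditive up to
   3 simplices and S(p, p) = 0, so the Euclidean algorithm fills S(x, m) at a
   cost linear in the sum of the partial quotients of m / x; and
   S(1, m) = S(x + 1, m) - S(x, m) with x close to sqrt m. *)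

Ltac chain_ring :=
  apply/eqP/freeg_eqP => ?; rewrite ?(coeffD, coeffN, coeff0, coeffZ); ring.

(** * Chains and filling cost *)

Section FreegExtra.
Variables (K : choiceType) (V : lmodType int).
Implicit Types (h : K -> V) (c : {freeg K / int}).

Lemma fgliftB h : {morph fglift h : x y / x - y}.
Proof. by move=> x y; exact: lift_is_additive. Qed.

HB.instance Definition _ h :=
  GRing.isZmodMorphism.Build {freeg K / int} V (fglift h) (fgliftB h).

Lemma fglift0 h : fglift h 0 = 0.
Proof. exact: raddf0. Qed.

Lemma fgliftD h : {morph fglift h : x y / x + y}.
Proof. exact: raddfD. Qed.

Lemma fgliftZ h (k : int) c : fglift h (k *: c) = k *: fglift h c.
Proof. by rewrite -[k]intz !scaler_int raddfMz. Qed.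

Lemma fgliftU1 h x : fglift h << x >> = h x.
Proof. by rewrite liftU scale1r. Qed.

Lemma freegUZ (k : int) (x : K) : << k *g x >> = k *: << x >> :> {freeg K / int}.
Proof. by rewrite -[in RHS](intz k) scaler_int freeg_mulz intz. Qed.

Lemma fgliftE h c : fglift h c = \sum_(x <- dom c) coeff x c *: h x.
Proof.
rewrite -{1}(freeg_sumE c) raddf_sum; apply: eq_bigr => x _ /=.
by rewrite liftU.
Qed.

(** Reduces identities between chain maps to single simplices. Additivity is asked as a bare
    equation, so that composites such as [boundary (subdivide c)] need no structure of their own. *)
Lemma additive_freeg_ext (f g : {freeg K / int} -> V) :
  {morph f : x y / x - y} -> {morph g : x y / x - y} ->
  (forall x, f << x >> = g << x >>) -> f =1 g.
Proof.
have lift_eq (h : {freeg K / int} -> V) : {morph h : x y / x - y} ->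
    h =1 fglift (fun x => h << x >>).
  move=> hB c; pose h' := GRing.isZmodMorphism.Build _ _ h hB.
  pose H : {additive _ -> _} := HB.pack h h'.
  rewrite fgliftE -{1}(freeg_sumE c) -[h]/(H : _ -> _) raddf_sum.
  apply: eq_bigr => x _; rewrite freegUZ -[in LHS](intz (coeff x c)).
  by rewrite scaler_int raddfMz -scaler_int intz.
by move=> fB gB fg c; rewrite (lift_eq f) // (lift_eq g) // (funext fg).
Qed.

End FreegExtra.

Section Norm.
Context (R : realType) (S : topologicalType).
Implicit Types n : nat.

Lemma norm1_sub n (c : chain R S n) (s : seq (sing R S n)) :
  uniq s -> {subset dom c <= s} -> norm1 c = (\sum_(x <- s) `|coeff x c|)%N.
Proof.
move=> us sub.
rewrite (bigID (mem (dom c))) /= [X in (_ + X)%N]big1 ?addn0; last first.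
  by move=> x; move/coeff_outdom => ->.
rewrite -big_filter; apply: perm_big; apply: uniq_perm.
- exact: uniq_dom.
- exact: filter_uniq.
- move=> x; rewrite mem_filter; case xd: (x \in dom c) => //=.
  by rewrite (sub _ xd).
Qed.

Lemma norm1D n (c d : chain R S n) : (norm1 (c + d)%R <= norm1 c + norm1 d)%N.
Proof.
pose s := undup (dom c ++ dom d).
have us : uniq s by exact: undup_uniq.
have sc : {subset dom c <= s} by move=> x xc; rewrite mem_undup mem_cat xc.
have sd : {subset dom d <= s} by move=> x xd; rewrite mem_undup mem_cat xd orbT.
rewrite (norm1_sub us sc) (norm1_sub us sd) (@norm1_sub _ _ s) //; last first.
  by move=> x /domD_subset; rewrite mem_undup.
rewrite -big_split /=; apply: leq_sum => x _; rewrite coeffD; lia.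
Qed.

Lemma norm1N n (c : chain R S n) : norm1 (- c) = norm1 c.
Proof.
rewrite (norm1_sub (uniq_dom c)); last by move=> x; rewrite domN.
by apply: eq_bigr => x _; rewrite coeffN abszN.
Qed.

Lemma norm1_0 n : norm1 (0 : chain R S n) = 0%N.
Proof. by rewrite /norm1 dom0 big_nil. Qed.

Lemma norm1U n (x : sing R S n) : norm1 (<< x >> : chain R S n) = 1%N.
Proof. by rewrite /norm1 domU1 big_seq1 coeffU mul1r eqxx. Qed.

(** Costs are recorded by explicit fillings with natural number bounds rather than by the infimum
    [filling_norm], so that they simply add up. *)
Definition fills n (K : nat) (c : chain R S n) :=
  exists b : chain R S n.+1, boundary b = c /\ (norm1 b <= K)%N.

Lemma boundaryB n : {morph @boundary R S n : x y / x - y}.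
Proof. exact: raddfB. Qed.

Lemma boundaryD n : {morph @boundary R S n : x y / x + y}.
Proof. exact: raddfD. Qed.

Lemma boundaryN n : {morph @boundary R S n : x / - x}.
Proof. exact: raddfN. Qed.

Lemma fills0 n K : fills K (0 : chain R S n).
Proof. by exists 0; rewrite norm1_0; split=> //; exact: fglift0. Qed.

Lemma fillsD n K L (c d : chain R S n) :
  fills K c -> fills L d -> fills (K + L) (c + d)%R.
Proof.
move=> [b [<- bK]] [e [<- eL]]; exists (b + e); split; first exact: boundaryD.
exact: leq_trans (norm1D _ _) (leq_add bK eL).
Qed.

Lemma fillsN n K (c : chain R S n) : fills K c -> fills K (- c).
Proof.
move=> [b [<- bK]]; exists (- b); split; first exact: boundaryN.
by rewrite norm1N.
Qed.

Lemma fillsB n K L (c d : chain R S n) :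
  fills K c -> fills L d -> fills (K + L) (c - d)%R.
Proof. by move=> Kc /fillsN; exact: fillsD. Qed.

Lemma fills_le n K L (c : chain R S n) : (K <= L)%N -> fills K c -> fills L c.
Proof. by move=> KL [b [bc bK]]; exists b; split=> //; exact: leq_trans bK KL. Qed.

Lemma fills_boundary n (b : chain R S n.+1) : fills (norm1 b) (boundary b).
Proof. by exists b. Qed.

Lemma fills_boundaryU n (x : sing R S n.+1) : fills 1 (boundary << x >>).
Proof. by rewrite -[X in fills X](norm1U x); exact: fills_boundary. Qed.

(* The rate [r] is the growth in [m] of the cost of filling the [m]-th chain. *)
Definition negl (r : nat -> nat) n (c : nat -> chain R S n) :=
  exists K, forall m, fills (K * r m) (c m).

Section Negl.
Variables (r : nat -> nat) (n : nat).
Implicit Types c d : nat -> chain R S n.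

Lemma negl0 : negl r (fun=> 0 : chain R S n).
Proof. by exists 0%N => m; exact: fills0. Qed.

Lemma neglD c d : negl r c -> negl r d -> negl r (fun m => c m + d m).
Proof.
by move=> [K Kc] [L Ld]; exists (K + L)%N => m; rewrite mulnDl; exact: fillsD.
Qed.

Lemma neglN c : negl r c -> negl r (fun m => - c m).
Proof. by move=> [K Kc]; exists K => m; exact: fillsN. Qed.

Lemma neglB c d : negl r c -> negl r d -> negl r (fun m => c m - d m).
Proof. by move=> rc /neglN; exact: neglD. Qed.

Lemma negl_ext c d : (forall m, d m = c m) -> negl r c -> negl r d.
Proof. by move=> dc [K Kc]; exists K => m; rewrite dc. Qed.

Lemma neglZ (k : int) c : negl r c -> negl r (fun m => k *: c m).
Proof.
have pos (j : nat) : negl r c -> negl r (fun m => j%:Z *: c m).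
  move=> rc; elim: j => [|j IHj].
    by apply: negl_ext negl0 => m; rewrite scale0r.
  by apply: negl_ext (neglD rc IHj) => m; rewrite intS scalerDl scale1r.
case: k => j rc; first exact: pos.
by apply: negl_ext (neglN (pos j.+1 rc)) => m; rewrite NegzE scaleNr.
Qed.

Lemma negl_sum (I : eqType) (s : seq I) (c : I -> nat -> chain R S n) :
  {in s, forall i, negl r (c i)} -> negl r (fun m => \sum_(i <- s) c i m).
Proof.
elim: s => [_|i s IHs H].
  by apply: negl_ext negl0 => m; rewrite big_nil.
have Hi : negl r (c i) by apply: H; rewrite mem_head.
have {}IHs : negl r (fun m => \sum_(j <- s) c j m).
  by apply: IHs => j js; apply: H; rewrite in_cons js orbT.
by apply: negl_ext (neglD Hi IHs) => m; rewrite big_cons.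
Qed.

Hypothesis r_gt0 : forall m, (0 < r m)%N.

Lemma negl_bounded K c : (forall m, fills K (c m)) -> negl r c.
Proof.
by move=> Kc; exists K => m; apply: fills_le (Kc m); rewrite leq_pmulr.
Qed.

End Negl.

(* Local-to-global: corrections that only depend on the faces cancel on a
   cycle. *)
Lemma negl_fglift r n (z : chain R S n.+1) (X : nat -> sing R S n.+1 -> chain R S n.+1)
    (Psi : nat -> sing R S n -> chain R S n.+1) :
  boundary z = 0 ->
  (forall s, s \in dom z ->
     negl r (fun m => X m s - fglift (Psi m) (boundary << s >>))) ->
  negl r (fun m => fglift (X m) z).
Proof.
move=> z0 H.
have := negl_sum (fun s sz => neglZ (coeff s z) (H s sz)).
apply: negl_ext => m; rewrite fgliftE.
under [RHS]eq_bigr do rewrite scalerBr; rewrite sumrB.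
suff -> : \sum_(s <- dom z) coeff s z *: fglift (Psi m) (boundary << s >>) = 0.
  by rewrite subr0.
rewrite -[RHS](fglift0 (Psi m)) -z0 [boundary z]fgliftE raddf_sum.
by apply: eq_bigr => s _ /=; rewrite fgliftZ /boundary fgliftU1.
Qed.

End Norm.

(** * The bar complex of Z *)

(** The successor keeps the rate positive at [m = 0], so that [negl_bounded] absorbs bounded
    costs. *)
Definition root_rate (m : nat) : nat := (Nat.sqrt m).+1.

Lemma sqrt_spec m : (Nat.sqrt m * Nat.sqrt m <= m < (Nat.sqrt m).+1 * (Nat.sqrt m).+1)%N.
Proof.
have [] := PeanoNat.Nat.sqrt_spec m (PeanoNat.Nat.le_0_l m).
by move=> /ssrnat.leP a /ssrnat.ltP b; apply/andP; split.
Qed.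

Section Bar.
Context (R : realType) (S : topologicalType) (n : nat).
Variable b : int -> int -> chain R S n.
Hypothesis cocycle :
  forall p q s, fills 1 (b q s - b (p + q) s + b p (q + s) - b p q).

(** When [b p q] is the bar simplex [[p|q]], this is the shuffle product of [[p]] and [[q]]: the
    image of the two-triangle cycle of a torus. *)
Definition shuffle p q := b p q - b q p.

Lemma shuffleC p q : shuffle p q = - shuffle q p.
Proof. by rewrite /shuffle opprB. Qed.

(** The three ways of inserting [q] into the pair [(p, p')] give three cocycle relations; in their
    alternating sum everything but the shuffles cancels. *)
Lemma shuffleDl p p' q :
  fills 3 (shuffle (p + p') q - shuffle p q - shuffle p' q).
Proof.
have := fillsN (fillsD (fillsB (cocycle p p' q) (cocycle p q p')) (cocycle q p p')).
rewrite (addrC q p') (addrC q p) /shuffle; congr (fills _ _); chain_ring.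
Qed.

Lemma shuffleDr p q q' :
  fills 3 (shuffle p (q + q') - shuffle p q - shuffle p q').
Proof.
have := fillsN (shuffleDl q q' p); congr (fills _ _).
by rewrite !(shuffleC p) ; chain_ring.
Qed.

Lemma shuffle_diag p : shuffle p p = 0.
Proof. exact: subrr. Qed.

Lemma shuffle0r p : fills 3 (shuffle p 0).
Proof.
by have := fillsN (shuffleDr p 0 0); rewrite addr0; congr (fills _ _); chain_ring.
Qed.

(** Since [shuffle x x = 0], each further [x] in the second argument costs only the biadditivity
    defect 3. *)
Lemma shuffle_mulnDr (x : int) (k : nat) (y : int) K :
  fills K (shuffle x y) -> fills (3 * k + K) (shuffle x (x * k%:Z + y)).
Proof.
move=> Ky; elim: k => [|k IHk]; first by rewrite mulr0 add0r muln0.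
have -> : x * k.+1%:Z + y = x + (x * k%:Z + y) by rewrite intS; ring.
apply: (@fills_le _ _ _ (3 + (3 * k + K))); first by lia.
have := fillsD (shuffleDr x x (x * k%:Z + y)) IHk; congr (fills _ _).
rewrite shuffle_diag; chain_ring.
Qed.

(* Subtractive Euclidean algorithm: each step costs three simplices. *)
Lemma shuffle_euclid (p q : nat) : fills (3 * (p + q) + 3) (shuffle p q).
Proof.
move: {2}(p + q)%N (leqnn (p + q)) => k.
elim: k p q => [|k IHk] p q pqk.
  have [-> ->] : p = 0%N /\ q = 0%N by lia.
  exact: shuffle0r.
have [->|p0] := eqVneq p 0%N.
  by rewrite shuffleC; apply/fillsN/(@fills_le _ _ _ 3) => //; [lia|exact: shuffle0r].
have [->|q0] := eqVneq q 0%N.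
  by apply/(@fills_le _ _ _ 3) => //; [lia|exact: shuffle0r].
wlog pq : p q pqk p0 q0 / (p <= q)%N => [wlg|].
  case/orP: (leq_total p q) => pq; first exact: wlg.
  by rewrite shuffleC (addnC p); apply: fillsN; apply: wlg => //; lia.
have /IHk step : (p + (q - p) <= k)%N by lia.
have -> : q%:Z = p%:Z * 1%:Z + (q - p)%N by lia.
by apply: fills_le (shuffle_mulnDr 1 step); lia.
Qed.

(** One division with remainder, then the subtractive algorithm on a pair of sum below [2 x]: the
    cost is of order [m / x + x], which is balanced for [x] near [sqrt m]. *)
Lemma shuffle_divn (x m : nat) : (0 < x)%N ->
  fills (3 * (m %/ x) + (3 * (x + m %% x) + 3)) (shuffle x m).
Proof.
move=> x0; have := shuffle_mulnDr (m %/ x) (shuffle_euclid x (m %% x)).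
by congr (fills _ (shuffle _ _)); rewrite -PoszM -PoszD mulnC -divn_eq.
Qed.

(* [1] is a difference of two numbers of size about [sqrt m]. *)
Lemma shuffle1_negl : negl root_rate (fun m => shuffle 1 m).
Proof.
(* [21 = 9 + 9 + 3]: two shuffles filled by division and one biadditivity defect. *)
exists 21%N => m; have [m0|m0] := posnP m.
  by rewrite m0; apply/(@fills_le _ _ _ 3) => //; exact: shuffle0r.
rewrite /root_rate; have := sqrt_spec m; set x := Nat.sqrt m => /andP[xm mx].
have x0 : (0 < x)%N by nia.
have fx : fills (9 * x.+1) (shuffle x m).
  apply: fills_le (shuffle_divn m x0).
  (* [m < (x + 1)^2 <= x (x + 3)] since [1 <= x]; the total is then at most [9 x + 6]. *)
  have : (m %/ x < x + 3)%N by rewrite ltn_divLR //; nia.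
  by have := ltn_pmod m x0; lia.
have fx1 : fills (9 * x.+1) (shuffle x.+1 m).
  apply: fills_le (shuffle_divn m (ltn0Sn x)).
  have : (m %/ x.+1 < x.+1)%N by rewrite ltn_divLR.
  by have := ltn_pmod m (ltn0Sn x); lia.
apply: (@fills_le _ _ _ (9 * x.+1 + (9 * x.+1 + 3))); first lia.
have := fillsB fx1 (fillsD fx (shuffleDl 1 x m)); rewrite intS.
by congr (fills _ _); chain_ring.
Qed.

(** The constant may depend on [k], which stays fixed while [m] grows, so finitely many additivity
    defects are harmless. *)
Lemma negl_linear (D : int -> nat -> chain R S n) :
  negl root_rate (D 1) ->
  (forall k l, negl root_rate (fun m => D (k + l) m - D k m - D l m)) ->
  forall k, negl root_rate (D k).
Proof.
move=> D1 DD.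
have D0 : negl root_rate (D 0).
  apply: negl_ext (neglN (DD 0 0)) => m; rewrite addr0; chain_ring.
have Dn (k : nat) : negl root_rate (D k).
  elim: k => // k IHk; apply: negl_ext (neglD (neglD (DD 1 k) D1) IHk) => m.
  by rewrite intS; chain_ring.
case=> k; first exact: Dn.
apply: negl_ext (neglB (neglB D0 (DD k.+1 (Negz k))) (Dn k.+1)) => m.
by rewrite NegzE subrr; chain_ring.
Qed.

(** Additivity in [q] and then in [al] reduces the claim to [al = q = 1], which is [shuffle1_negl]
    up to sign. *)
Lemma shuffle_negl (al q : int) : negl root_rate (fun m => shuffle (m%:Z * al) q).
Proof.
move: q; apply: negl_linear => [|k l]; last first.
  exists 3%N => m; apply: fills_le (shuffleDr _ k l); rewrite /root_rate; lia.
move: al; apply: negl_linear => [|k l].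
  by apply: negl_ext (neglN shuffle1_negl) => m; rewrite mulr1 shuffleC.
exists 3%N => m; rewrite mulrDr; apply: fills_le (shuffleDl _ _ _).
rewrite /root_rate; lia.
Qed.

(** In the extension of Z with law [(x, p) (y, q) = (x + y + b p q, p + q)], taken modulo
    boundaries, this is minus the central coordinate of the [k]-th power of [(0, g)]. The unit is
    [(- b 0 0, 0)], whence the term [b 0 0]. *)
Definition power_chain (g k : int) : chain R S n :=
  match k with
  | Posz k => b 0 0 - \sum_(i < k) b (g * i) g
  | Negz k => b 0 0 + \sum_(i < k.+1) b (g * Negz i) g
  end.

Lemma power_chain0 g : power_chain g 0 = b 0 0.
Proof. by rewrite /= big_ord0 subr0. Qed.

Lemma power_chainS g k : power_chain g (k + 1) = power_chain g k - b (g * k) g.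
Proof.
case: k => [k|[|k]].
- by rewrite /= addn1 big_ord_recr /= opprD addrA.
- by rewrite /= big_ord0 big_ord1 /= subr0 addrK.
- rewrite (_ : Negz k.+1 + 1 = Negz k); last by lia.
  by rewrite /= [in RHS]big_ord_recr /= addrA addrK.
Qed.

Lemma cocycle0r p : fills 1 (b p 0 - b 0 0).
Proof.
by have := fillsN (cocycle p 0 0); rewrite !addr0; congr (fills _ _); chain_ring.
Qed.

(* Over a cyclic group the cocycle is a coboundary. *)
Lemma power_chainP (k l : int) : exists K, forall g, fills K
  (b (g * k) (g * l) - (power_chain g k + power_chain g l - power_chain g (k + l))).
Proof.
(* [K] comes before [g] because [g = m] in a later application. *)
pose P l := exists K, forall g, fills K (b (g * k) (g * l) -
  (power_chain g k + power_chain g l - power_chain g (k + l))).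
have P0 : P 0.
  exists 1%N => g; have := cocycle0r (g * k); rewrite mulr0 addr0 power_chain0.
  by congr (fills _ _); chain_ring.
(* The simplex [[g k|g l'|g]] compares the claims at [l'] and [l' + 1], which serves for both the
   upward and the downward induction. *)
have step l' : exists K, forall g, fills K
  (b (g * k) (g * (l' + 1)) -
    (power_chain g k + power_chain g (l' + 1) - power_chain g (k + (l' + 1)))
   - (b (g * k) (g * l') - (power_chain g k + power_chain g l' - power_chain g (k + l')))).
  exists 1%N => g; have := cocycle (g * k) (g * l') g.
  rewrite addrA !power_chainS !mulrDr !mulr1.
  by congr (fills _ _); chain_ring.
have PS l' : P l' -> P (l' + 1).
  move=> [K HK]; have [L HL] := step l'; exists (L + K)%N => g.
  have := fillsD (HL g) (HK g); rewrite subrK.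
  by congr (fills _ _).
have PP l' : P (l' + 1) -> P l'.
  move=> [K HK]; have [L HL] := step l'; exists (K + L)%N => g.
  have := fillsB (HK g) (HL g); congr (fills _ _); chain_ring.
case: l => l; first by elim: l => // l /PS; rewrite addrC -intS.
rewrite NegzE; elim: l.+1 => [|j IHj] //; apply: PP.
by congr (P _): IHj; lia.
Qed.

(** Minus the central coordinate of [A^p B^al], where [A = (0, 1)] and [B = (0, m)]. *)
Definition split_chain (m : nat) (p al : int) : chain R S n :=
  power_chain 1 p + power_chain m al - b p (m%:Z * al).

(** For edges whose ends lie on the same side of the core, where [al = 0]. *)
Lemma split_chain0 m p : split_chain m p 0 = split_chain 0 p 0.
Proof. by rewrite /split_chain !power_chain0 !mulr0. Qed.

(* The central extension of Z^2 defined by the cocycle, written with the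
   section (p, al) |-> A^p B^al; its commutator pairing is [shuffle]. *)
Lemma split_chainP (p al q be : int) : negl root_rate (fun m =>
  b (p + m%:Z * al) (q + m%:Z * be) -
  (split_chain m p al + split_chain m q be - split_chain m (p + q) (al + be))).
Proof.
have [K HK] := power_chainP p q.
have [L HL] := power_chainP al be.
(* Four reassociations from [(p + m al) + (q + m be)] to [(p + q) + (m al + m be)]; the first two
   exchange [m al] and [q] and produce the shuffle. *)
have c m := fillsD (fillsB (cocycle (m%:Z * al) q (m%:Z * be))
    (cocycle q (m%:Z * al) (m%:Z * be)))
  (fillsB (cocycle p q (m%:Z * al + m%:Z * be))
    (cocycle p (m%:Z * al) (q + m%:Z * be))).
have bounded : negl root_rate (fun m =>
  b (p + m%:Z * al) (q + m%:Z * be) -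
  (split_chain m p al + split_chain m q be - split_chain m (p + q) (al + be)) -
  shuffle (m%:Z * al) q).
  apply: (@negl_bounded _ _ root_rate _ _ (K + L + 4)%N) => // m.
  have := fillsD (fillsD (HK 1) (HL m)) (c m).
  rewrite !mul1r /split_chain /shuffle (addrC (m%:Z * al) q) mulrDr.
  rewrite (addrCA (m%:Z * al) q).
  by congr (fills _ _); chain_ring.
apply: negl_ext (neglD bounded (shuffle_negl al q)) => m; chain_ring.
Qed.

End Bar.

(** * Affine simplices *)

Section Continuity.
Context (R : realType).

Lemma continuous_sumr (T : topologicalType) (E : normedModType R) n
    (F : 'I_n -> T -> E) :
  (forall i, continuous (F i)) -> continuous (fun x => \sum_i F i x).
Proof.
by move=> cF; apply: continuous_big => //; exact: add_continuous.
Qed.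

Lemma continuous_row (T U : topologicalType) n (f : T -> 'rV[U]_n) :
  (forall j, continuous (fun x => f x 0 j)) -> continuous f.
Proof.
move=> cf x A [P Pnbhs PA]; rewrite nbhs_simpl.
have : \forall y \near x, forall j, P 0 j (f y 0 j).
  by apply: filter_forall => j; exact: (cf j x _ (Pnbhs 0 j)).
by apply: filterS => y Py; apply: PA => i j; rewrite (ord1 i).
Qed.

Lemma continuous_pair (T U V : topologicalType) (f : T -> U) (g : T -> V) :
  continuous f -> continuous g -> continuous (fun x => (f x, g x)).
Proof. by move=> cf cg x; apply: cvg_pair; [exact: cf|exact: cg]. Qed.

Section RealFunctions.
Variables (T : topologicalType) (f g : T -> R).
Hypotheses (cf : continuous f) (cg : continuous g).

Lemma continuous_add : continuous (fun t => f t + g t).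
Proof. by move=> t; apply: (@cvgD _ R^o); [exact: cf|exact: cg]. Qed.

Lemma continuous_sub : continuous (fun t => f t - g t).
Proof. by move=> t; apply: (@cvgB _ R^o); [exact: cf|exact: cg]. Qed.

Lemma continuous_mul : continuous (fun t => f t * g t).
Proof. by move=> t; apply: cvgM; [exact: cf|exact: cg]. Qed.

Lemma continuous_maxr : continuous (fun t => Num.max (f t) (g t)).
Proof. by move=> t; apply: (@continuous_max R T f g); [exact: cf|exact: cg]. Qed.

Lemma continuous_minr : continuous (fun t => Num.min (f t) (g t)).
Proof. by move=> t; apply: (@continuous_min R T f g); [exact: cf|exact: cg]. Qed.

Lemma continuous_inv : (forall t, f t != 0) -> continuous (fun t => (f t)^-1).
Proof. by move=> f0 t; apply: cvgV; [exact: f0|exact: cf]. Qed.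

End RealFunctions.

Lemma continuous_simplex n (T : topologicalType) (f : T -> simplex R n) :
  continuous (fun x => val (f x)) -> continuous f.
Proof. exact: continuous_comp_initial. Qed.

Lemma continuous_val_simplex n : continuous (val : simplex R n -> _).
Proof. exact: initial_continuous. Qed.

End Continuity.

Section AffineSimplices.
Context (R : realType) (S : topologicalType).

Definition aff (E : lmodType R) n (w : seq E) (x : 'rV[R]_n.+1) : E :=
  \sum_i x 0 i *: w`_i.

Lemma continuous_aff (E : normedModType R) n (w : seq E) :
  continuous (@aff E n w).
Proof.
apply: continuous_sumr => i x.
apply: (@continuous_comp _ _ _ (fun x : 'rV[R]_n.+1 => x 0 i) (fun k : R => k *: w`_i)).
  exact: coord_continuous.
exact: scalel_continuous.
Qed.

Lemma aff_linear (E E' : lmodType R) n (L : {linear E -> E'}) (w : seq E)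
    (x : 'rV[R]_n.+1) : size w = n.+1 -> L (aff w x) = aff (map L w) x.
Proof.
move=> sw; rewrite /aff linear_sum; apply: eq_bigr => i _.
by rewrite linearZ /= (nth_map 0) // sw.
Qed.

Lemma asim_continuous (E : normedModType R) (G : continuousType E S) n (w : seq E) :
  continuous (fun x : simplex R n => G (aff w (val x))).
Proof.
move=> x; apply: (@continuous_comp _ _ _ (fun x : simplex R n => aff w (val x)) G).
  apply: (@continuous_comp _ _ _ (val : simplex R n -> _) (@aff E n w)).
    exact: continuous_val_simplex.
  exact: continuous_aff.
exact: cts_fun.
Qed.

(** [G] is defined on the whole space, so any list of vertices is allowed and no convexity condition
    has to be carried along. *)
Definition asim (E : normedModType R) (G : continuousType E S) n (w : seq E) :
  sing R S n := mkcts (@asim_continuous E G n w).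

Lemma asim_face (E : normedModType R) (G : continuousType E S) n (w : seq E)
    (i : 'I_n.+2) : size w = n.+2 ->
  asim G n.+1 w \o face R i = asim G n (take i w ++ drop i.+1 w) :> sing R S n.
Proof.
move=> sw; apply/continuousEP => x; congr (G _).
rewrite /aff /= (bigD1_ord i) //= mxE unlift_none scale0r add0r.
apply: eq_bigr => j _; rewrite mxE liftK /=; congr (_ *: _).
rewrite nth_cat size_take sw ltn_ord /= /bump.
case: leqP => ij; first by rewrite nth_drop; congr (_`_ _); lia.
by rewrite add0n nth_take.
Qed.

Lemma boundary_asim2 (E : normedModType R) (G : continuousType E S) (a b c : E) :
  boundary << asim G 2 [:: a; b; c] >> =
  << asim G 1 [:: b; c] >> - << asim G 1 [:: a; c] >> + << asim G 1 [:: a; b] >>.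
Proof.
rewrite /boundary fgliftU1 !big_ord_recl big_ord0 !asim_face //= /bump /=.
rewrite !(freegUZ ((-1) ^+ _)) expr0 expr1 scale1r scaleN1r.
rewrite (_ : (-1) ^+ (1 + 1) = 1 :> int) // scale1r.
chain_ring.
Qed.

Lemma boundary_asim3 (E : normedModType R) (G : continuousType E S) (a b c d : E) :
  boundary << asim G 3 [:: a; b; c; d] >> =
  << asim G 2 [:: b; c; d] >> - << asim G 2 [:: a; c; d] >>
  + << asim G 2 [:: a; b; d] >> - << asim G 2 [:: a; b; c] >>.
Proof.
rewrite /boundary fgliftU1 !big_ord_recl big_ord0 !asim_face //= /bump /=.
rewrite !(freegUZ ((-1) ^+ _)) expr0 expr1 scale1r scaleN1r.
rewrite (_ : (-1) ^+ (1 + 1) = 1 :> int) // scale1r.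
rewrite (_ : (-1) ^+ (1 + (1 + 1)) = -1 :> int) // scaleN1r.
chain_ring.
Qed.

Lemma boundary_sing2 (s : sing R S 2) :
  boundary << s >> = << s \o face R 0 : sing R S 1 >>
   - << s \o face R 1 : sing R S 1 >> + << s \o face R 2%:R : sing R S 1 >>.
Proof.
rewrite /boundary fgliftU1 !big_ord_recl big_ord0 /= /bump /=.
rewrite !(freegUZ ((-1) ^+ _)) expr0 expr1 scale1r scaleN1r.
rewrite (_ : (-1) ^+ (1 + 1) = 1 :> int) // scale1r.
rewrite (_ : fintype.lift ord0 ord0 = 1 :> 'I_3); last exact: val_inj.
rewrite (_ : fintype.lift ord0 (fintype.lift ord0 ord0) = 2%:R :> 'I_3); last exact: val_inj.
chain_ring.
Qed.

Section Convex.
Context (n : nat).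
Implicit Types (x y : 'rV[R]_n.+1).

Lemma aff_simplex m (w : seq 'rV[R]_n.+1) (x : simplex R m) :
  size w = m.+1 -> {in w, forall y, @simplex_set R n y} ->
  @simplex_set R n (aff w (val x)).
Proof.
move=> sw Hw; have [x0 x1] := set_valP x.
have {}Hw (i : 'I_m.+1) : @simplex_set R n w`_i.
  by apply: Hw; rewrite mem_nth // sw.
split=> [j|].
  rewrite summxE; apply: sumr_ge0 => i _; rewrite mxE mulr_ge0 //.
  by have [] := Hw i.
under eq_bigr do rewrite summxE; rewrite exchange_big /= -[RHS]x1.
apply: eq_bigr => i _; under eq_bigr do rewrite mxE.
by rewrite -mulr_sumr; have [_ ->] := Hw i; rewrite mulr1.
Qed.

Definition vtx (i : nat) : 'rV[R]_n.+1 := \row_j ((j : nat) == i)%:R.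

Lemma vtx_simplex i : (i < n.+1)%N -> @simplex_set R n (vtx i).
Proof.
move=> i_n; split=> [j|]; first by rewrite mxE ler0n.
rewrite (bigD1 (Ordinal i_n)) //= mxE eqxx big1 ?addr0 // => j ji.
by rewrite mxE; case: eqP => // jE; rewrite -val_eqE /= jE eqxx in ji.
Qed.

Lemma aff_vtx x : aff (mkseq vtx n.+1) x = x.
Proof.
apply/rowP => j; rewrite summxE (bigD1 j) //= big1 => [|i ij].
  by rewrite addr0 mxE nth_mkseq // mxE eqxx mulr1.
rewrite mxE nth_mkseq // mxE; case: eqP => [jE|]; rewrite ?mulr0 //.
by rewrite -val_eqE /= jE eqxx in ij.
Qed.

(* A retraction of the whole space onto the standard simplex, which makes
   every singular simplex the restriction of a globally defined map. *)
Definition retr_sum x := \sum_i Num.max 0 (x 0 i).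

(** A total below 1 is topped up evenly before dividing, so that the denominator is at least 1 even
    where no coordinate is positive. *)
Definition retr x : 'rV[R]_n.+1 :=
  \row_j ((Num.max 0 (x 0 j) + Num.max 0 (1 - retr_sum x) / n.+1%:R)
          / Num.max 1 (retr_sum x)).

Lemma retr_simplex x : retr x \in @simplex_set R n.
Proof.
apply/mem_set; have m1 : 0 < Num.max 1 (retr_sum x) by rewrite lt_max ltr01.
split=> [j|].
  rewrite mxE divr_ge0 ?(ltW m1) // addr_ge0 ?divr_ge0 //; by rewrite le_max lexx.
under eq_bigr do rewrite mxE.
rewrite -mulr_suml big_split /= -/(retr_sum x) sumr_const card_ord.
rewrite -mulrnAl -mulr_natr mulfK ?pnatr_eq0 //.
apply: (mulIf (lt0r_neq0 m1)); rewrite mul1r mulfVK ?gt_eqF //.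
case: (leP 1 (retr_sum x)) => h.
  by rewrite (_ : Num.max 0 _ = 0) ?addr0 //; apply/max_idPl; lra.
by rewrite (_ : Num.max 0 _ = 1 - retr_sum x) ?subrKC //; apply/max_idPr; lra.
Qed.

Lemma retr_id x : @simplex_set R n x -> retr x = x.
Proof.
move=> [x0 x1]; have px j : Num.max 0 (x 0 j) = x 0 j by apply/max_idPr.
have s1 : retr_sum x = 1 by rewrite -[RHS]x1; apply: eq_bigr => i _; exact: px.
by apply/rowP => j; rewrite mxE s1 subrr px !maxxx mul0r addr0 divr1.
Qed.

Lemma continuous_retr : continuous retr.
Proof.
have cc (k : R) : continuous (fun _ : 'rV[R]_n.+1 => k) by exact: cst_continuous.
have c0 j : continuous (fun x : 'rV[R]_n.+1 => Num.max 0 (x 0 j)).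
  by apply: continuous_maxr; [exact: cc|exact: coord_continuous].
have cs : continuous retr_sum.
  by apply: (@continuous_sumr R _ R^o) => j; exact: c0.
apply: continuous_row => j; under eq_fun do rewrite mxE.
apply: continuous_mul.
  apply: continuous_add; first exact: c0.
  apply: continuous_mul => //; apply: continuous_maxr => //.
  exact: continuous_sub.
by apply: continuous_inv => [|x]; [exact: continuous_maxr|rewrite gt_eqF // lt_max ltr01].
Qed.

Definition retr_fun x : simplex R n := exist _ (retr x) (retr_simplex x).

Lemma continuous_retr_fun : continuous retr_fun.
Proof. by apply: continuous_simplex; exact: continuous_retr. Qed.

Definition retraction : continuousType 'rV[R]_n.+1 (simplex R n) :=
  mkcts continuous_retr_fun.

Lemma retractionK (x : simplex R n) : retraction (val x) = x.
Proof. by apply/val_inj/retr_id; exact: set_valP. Qed.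

Definition ext (s : sing R S n) : continuousType 'rV[R]_n.+1 S := s \o retraction.

Lemma extE s (x : simplex R n) : ext s (val x) = s x.
Proof. by rewrite /ext /= retractionK. Qed.

Lemma asim_ext s : asim (ext s) n (mkseq vtx n.+1) = s.
Proof. by apply/continuousEP => x; rewrite -[LHS]/(ext s _) aff_vtx extE. Qed.

End Convex.

Lemma face_vec_is_linear n (i : 'I_n.+2) : linear (@face_vec R n i).
Proof.
move=> k x y; apply/rowP => j; rewrite !mxE.
by case: unliftP => [j' _|_] /=; rewrite ?mxE // mulr0 addr0.
Qed.

HB.instance Definition _ n (i : 'I_n.+2) :=
  GRing.isLinear.Build R _ _ _ (@face_vec R n i) (face_vec_is_linear i).

Lemma face_vec_vtx n (i : 'I_n.+2) j :
  face_vec i (vtx n j) = vtx n.+1 (bump i j).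
Proof.
apply/rowP => k; rewrite !mxE; case: unliftP => [k' ->|->] /=.
  by rewrite mxE (can_eq (@bumpK i)).
by rewrite (negPf (neq_bump i j)).
Qed.

End AffineSimplices.
Arguments vtx {R n} i.
Arguments retraction {R n}.

Lemma fglift_sub (K : choiceType) (V : lmodType int) (g h : K -> V) (c : {freeg K / int}) :
  fglift (fun x => g x - h x) c = fglift g c - fglift h c.
Proof.
rewrite !fgliftE -sumrB; apply: eq_bigr => x _; exact: scalerBr.
Qed.

(** * Prisms and homotopy invariance *)

Section Prism.
Context (R : realType) (S : topologicalType).

Section Vertices.
Context (E : normedModType R) (G : continuousType E S).

Definition prism1 (a b a' b' : E) : chain R S 2 :=
  << asim G 2 [:: a; a'; b'] >> - << asim G 2 [:: a; b; b'] >>.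

Definition prism2 (a b c a' b' c' : E) : chain R S 3 :=
  << asim G 3 [:: a; a'; b'; c'] >> - << asim G 3 [:: a; b; b'; c'] >>
  + << asim G 3 [:: a; b; c; c'] >>.

Lemma boundary_prism2 a b c a' b' c' : boundary (prism2 a b c a' b' c') =
  << asim G 2 [:: a'; b'; c'] >> - << asim G 2 [:: a; b; c] >>
  - (prism1 b c b' c' - prism1 a c a' c' + prism1 a b a' b').
Proof.
rewrite /prism2 /prism1 boundaryD boundaryB !boundary_asim3; chain_ring.
Qed.

Lemma norm1_prism2 a b c a' b' c' : (norm1 (prism2 a b c a' b' c') <= 3)%N.
Proof.
apply: leq_trans (norm1D _ _) _; rewrite norm1U (leq_add2r _ _ 2).
by apply: leq_trans (norm1D _ _) _; rewrite norm1N !norm1U.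
Qed.

End Vertices.

Section Cylinder.
Context (n : nat).
Implicit Types (K : continuousType (simplex R n * R^o)%type S).

Lemma cylinder_continuous K :
  continuous (fun p : 'rV[R]_n.+1 * R^o => K (retraction p.1, p.2)).
Proof.
move=> p; apply: (@continuous_comp _ _ _
  (fun p : 'rV[R]_n.+1 * R^o => (retraction p.1, p.2)) K); last exact: cts_fun.
apply: continuous_pair => {}p; last exact: cvg_snd.
apply: (@continuous_comp _ _ _ (fst : 'rV[R]_n.+1 * R^o -> _) (@retraction R n)).
  exact: cvg_fst.
exact: cts_fun.
Qed.

(** Extends a homotopy of a simplex to a normed space, so that its prism consists of affine
    simplices [asim]. *)
Definition cylinder K : continuousType ('rV[R]_n.+1 * R^o)%type S :=
  mkcts (@cylinder_continuous K).

Lemma slice_continuous K s : continuous (fun x : simplex R n => K (x, s)).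
Proof.
move=> x; apply: (@continuous_comp _ _ _ (fun x : simplex R n => (x, s : R^o)) K).
  by apply: continuous_pair => {}x; [exact: cvg_id|exact: cst_continuous].
exact: cts_fun.
Qed.

Definition slice K s : sing R S n := mkcts (@slice_continuous K s).

Definition level_vtx (s : R) (i : nat) : 'rV[R]_n.+1 * R^o := (vtx i, s).

Lemma aff_pair m (w : seq ('rV[R]_n.+1 * R^o)) (x : 'rV[R]_m.+1) :
  size w = m.+1 -> aff w x = (aff (map fst w) x, aff (map snd w) x).
Proof.
move=> sw; rewrite [LHS]surjective_pairing.
congr pair; exact: aff_linear.
Qed.

Lemma asim_cylinder_slice K s :
  asim (cylinder K) n (mkseq (level_vtx s) n.+1) = slice K s.
Proof.
apply/continuousEP => x; have [_ x1] := set_valP x.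
rewrite -[LHS]/(cylinder K _) aff_pair ?size_mkseq // -!map_comp.
rewrite -[RHS]/(K (x, s)) -[LHS]/(K (_, _)) aff_vtx retractionK; congr (K (_, _)).
rewrite /aff (eq_bigr (fun i => val x 0 i * s)) => [|i _].
  by rewrite -mulr_suml x1 mul1r.
by rewrite (nth_map 0%N) ?size_iota.
Qed.

End Cylinder.

Lemma cylinder_face_continuous n (K : continuousType (simplex R n.+1 * R^o)%type S)
    (i : 'I_n.+2) :
  continuous (fun p : simplex R n * R^o => K (face R i p.1, p.2)).
Proof.
move=> p; apply: (@continuous_comp _ _ _
  (fun p : simplex R n * R^o => (face R i p.1, p.2)) K); last exact: cts_fun.
apply: continuous_pair => {}p; last exact: cvg_snd.
apply: (@continuous_comp _ _ _ (fst : simplex R n * R^o -> _) (face R i)).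
  exact: cvg_fst.
exact: cts_fun.
Qed.

Definition cylinder_face n K (i : 'I_n.+2) :
    continuousType (simplex R n * R^o)%type S :=
  mkcts (@cylinder_face_continuous n K i).

(** [retraction] does not commute with [face_vec] off the simplex, hence the condition on the
    vertices; by convexity the whole affine simplex then stays inside. *)
Lemma asim_cylinder_face n (K : continuousType (simplex R n.+1 * R^o)%type S)
    (i : 'I_n.+2) m (w : seq ('rV[R]_n.+1 * R^o)) :
  size w = m.+1 -> {in map fst w, forall y, @simplex_set R n y} ->
  asim (cylinder (cylinder_face K i)) m w =
  asim (cylinder K) m (map (fun p => (face_vec i p.1, p.2)) w).
Proof.
move=> sw wP; apply/continuousEP => x.
have yP := aff_simplex (w := map fst w) x; rewrite size_map in yP.
move: (yP sw wP) => {}yP.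
rewrite -[LHS]/(cylinder _ _) -[RHS]/(cylinder _ _) !aff_pair ?size_map //.
set w' := map (fun p => (face_vec i p.1, p.2)) w.
have -> : map fst w' = map (face_vec i) (map fst w).
  by rewrite -!map_comp.
have -> : map snd w' = map snd w by rewrite -map_comp.
rewrite -[LHS]/(K (face R i _, _)) -[RHS]/(K (_, _)); congr (K (_, _)).
rewrite /= -[aff (map (face_vec i) _) _](aff_linear (@face_vec R n i)) ?size_map //=.
pose y : simplex R n := exist _ (aff (map fst w) (val x)) (mem_set yP).
by rewrite -[aff (map fst w) _]/(val y) -[face_vec i _]/(val (face R i y)) !retractionK.
Qed.

Definition cyl_prism1 (K : continuousType (simplex R 1 * R^o)%type S) :=
  prism1 (cylinder K) (level_vtx 1 0 0) (level_vtx 1 0 1) (level_vtx 1 1 0) (level_vtx 1 1 1).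

Definition cyl_prism2 (K : continuousType (simplex R 2 * R^o)%type S) :=
  prism2 (cylinder K) (level_vtx 2 0 0) (level_vtx 2 0 1) (level_vtx 2 0 2)
    (level_vtx 2 1 0) (level_vtx 2 1 1) (level_vtx 2 1 2).

Lemma cyl_prism1_face K (i : 'I_3) : cyl_prism1 (cylinder_face K i) =
  let v s j := level_vtx 2 s (bump i j) in
  prism1 (cylinder K) (v 0 0%N) (v 0 1%N) (v 1 0%N) (v 1 1%N).
Proof.
rewrite /cyl_prism1 /prism1; congr (<< _ >> - << _ >>);
  rewrite asim_cylinder_face //= ?face_vec_vtx //;
  by move=> y; rewrite !inE => /or3P[] /eqP ->; exact: vtx_simplex.
Qed.

Lemma boundary_cyl_prism2 K : boundary (cyl_prism2 K) =
  << slice K 1 >> - << slice K 0 >>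
  - (cyl_prism1 (cylinder_face K 0) - cyl_prism1 (cylinder_face K 1)
     + cyl_prism1 (cylinder_face K 2%:R)).
Proof. by rewrite boundary_prism2 !cyl_prism1_face -!asim_cylinder_slice. Qed.

Lemma fills_cyl_prism2 K : fills 3 (<< slice K 1 >> - << slice K 0 >>
  - (cyl_prism1 (cylinder_face K 0) - cyl_prism1 (cylinder_face K 1)
     + cyl_prism1 (cylinder_face K 2%:R))).
Proof.
exists (cyl_prism2 K); split; first exact: boundary_cyl_prism2.
exact: norm1_prism2.
Qed.

Section Homotopy.
Implicit Types (F : continuousType (R^o * S)%type S).

Lemma stage_continuous F (t : R) : continuous (fun y : S => F (t, y)).
Proof.
move=> x; apply: (@continuous_comp _ _ _ (fun y : S => (t : R^o, y)) F).
  by apply: continuous_pair => {}x; [exact: cst_continuous|exact: cvg_id].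
exact: cts_fun.
Qed.

Definition stage F t : continuousType S S := mkcts (@stage_continuous F t).

Lemma homotopy_cylinder_continuous F n (s : sing R S n) :
  continuous (fun p : simplex R n * R^o => F (p.2, s p.1)).
Proof.
move=> p; apply: (@continuous_comp _ _ _
  (fun p : simplex R n * R^o => (p.2, s p.1)) F); last exact: cts_fun.
apply: continuous_pair => {}p; first exact: cvg_snd.
apply: (@continuous_comp _ _ _ (fst : simplex R n * R^o -> _) s); first exact: cvg_fst.
exact: cts_fun.
Qed.

Definition homotopy_cylinder F n (s : sing R S n) :
    continuousType (simplex R n * R^o)%type S :=
  mkcts (@homotopy_cylinder_continuous F n s).

(** Three simplices per simplex of [z] suffice whatever the homotopy is, so [F] may vary with [m]
    without control. The prisms over the edges cancel on a cycle. *)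
Lemma push_homotopic (r : nat -> nat) (r_gt0 : forall m, (0 < r m)%N)
    (F : nat -> continuousType (R^o * S)%type S) (z : chain R S 2) :
  boundary z = 0 ->
  negl r (fun m => push (stage (F m) 1) z - push (stage (F m) 0) z).
Proof.
move=> z0.
apply: (@negl_ext _ _ _ _ (fun m => fglift (fun s : sing R S 2 =>
    << stage (F m) 1 \o s : sing R S 2 >> - << stage (F m) 0 \o s : sing R S 2 >>) z)).
  by move=> m; rewrite fglift_sub.
apply: (negl_fglift (Psi := fun m e => cyl_prism1 (homotopy_cylinder (F m) e))) => // s _.
apply: negl_bounded => // m; have := fills_cyl_prism2 (homotopy_cylinder (F m) s).
congr (fills 3 _); rewrite boundary_sing2 fgliftD fgliftB !fgliftU1.
congr (<< _ >> - << _ >> - (cyl_prism1 _ - cyl_prism1 _ + cyl_prism1 _));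
  exact/continuousEP.
Qed.

End Homotopy.

End Prism.

(** * Subdivision *)

Section PushNorm.
Context (R : realType) (S : topologicalType).

Lemma norm1_sum n (I : Type) (s : seq I) (c : I -> chain R S n) :
  (norm1 (\sum_(i <- s) c i)%R <= \sum_(i <- s) norm1 (c i))%N.
Proof.
elim: s => [|i s IHs]; first by rewrite !big_nil norm1_0.
by rewrite !big_cons (leq_trans (norm1D _ _)) // leq_add2l.
Qed.

Lemma norm1Z_le n (k : int) (x : sing R S n) :
  (norm1 (k *: << x >> : chain R S n) <= `|k|)%N.
Proof.
rewrite -freegUZ; have [->|k0] := eqVneq k 0; first by rewrite freegU0 norm1_0.
by rewrite /norm1 domU // big_seq1 coeffU eqxx mulr1.
Qed.

Lemma norm1_push n (f : continuousType S S) (c : chain R S n) :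
  (norm1 (push f c) <= norm1 c)%N.
Proof.
rewrite /push fgliftE (leq_trans (norm1_sum _ _)) // /norm1.
by apply: leq_sum => s _; exact: norm1Z_le.
Qed.

Lemma push_boundary n (f : continuousType S S) (c : chain R S n.+1) :
  push f (boundary c) = boundary (push f c).
Proof.
apply: (@additive_freeg_ext _ _ (fun c => push f (boundary c))
  (fun c => boundary (push f c))) => [x y|x y|s].
- by rewrite boundaryB /push fgliftB.
- by rewrite /push fgliftB boundaryB.
rewrite /push /boundary !fgliftU1 raddf_sum; apply: eq_bigr => i _ /=.
rewrite freegUZ fgliftZ fgliftU1 -freegUZ; congr (<< _ *g _ >>).
exact/continuousEP.
Qed.

Lemma mem_dom_fglift (K L : choiceType) (h : K -> {freeg L / int})
    (c : {freeg K / int}) y :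
  y \in dom (fglift h c) -> exists2 x, x \in dom c & y \in dom (h x).
Proof.
rewrite fgliftE => /dom_sum_subset /flatten_mapP [x].
by rewrite mem_filter => /andP[_ xc] /domZ_subset yh; exists x.
Qed.

End PushNorm.

Section Subdivision.
Context (R : realType) (S : topologicalType).

Definition midpoint (E : lmodType R) (a b : E) : E := 2^-1 *: (a + b).

Lemma midpoint_linear (E E' : lmodType R) (L : {linear E -> E'}) a b :
  L (midpoint a b) = midpoint (L a) (L b).
Proof. by rewrite /midpoint linearZ linearD. Qed.

Section Vertices.
Context (E : normedModType R) (G : continuousType E S).
Implicit Types a b c : E.

Definition subdiv1 a b : chain R S 1 :=
  let m := midpoint a b in << asim G 1 [:: a; m] >> + << asim G 1 [:: m; b] >>.

(** Edgewise subdivision into four triangles with halved edges. The order of its vertices reverses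
    the middle one, hence its sign. *)
Definition subdiv2 a b c : chain R S 2 :=
  let mab := midpoint a b in let mac := midpoint a c in let mbc := midpoint b c in
  << asim G 2 [:: a; mab; mac] >> + << asim G 2 [:: mab; b; mbc] >>
  + << asim G 2 [:: mac; mbc; c] >> - << asim G 2 [:: mab; mac; mbc] >>.

Definition subdiv_htpy1 a b : chain R S 2 := << asim G 2 [:: a; midpoint a b; b] >>.

(* The cone with apex [a] over the cycle to be filled. *)
Definition subdiv_htpy2 a b c : chain R S 3 :=
  let mab := midpoint a b in let mac := midpoint a c in let mbc := midpoint b c in
  << asim G 3 [:: a; a; mab; mac] >> + << asim G 3 [:: a; mab; b; mbc] >>
  + << asim G 3 [:: a; mac; mbc; c] >> - << asim G 3 [:: a; mab; mac; mbc] >>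
  - << asim G 3 [:: a; a; b; c] >>
  - << asim G 3 [:: a; b; mbc; c] >> + << asim G 3 [:: a; a; mac; c] >>
  - << asim G 3 [:: a; a; mab; b] >>.

Lemma boundary_subdiv2 a b c :
  boundary (subdiv2 a b c) = subdiv1 b c - subdiv1 a c + subdiv1 a b.
Proof.
rewrite /subdiv2 /subdiv1 /= !(boundaryB, boundaryD) !boundary_asim2; chain_ring.
Qed.

Lemma boundary_subdiv_htpy2 a b c : boundary (subdiv_htpy2 a b c) =
  subdiv2 a b c - << asim G 2 [:: a; b; c] >>
  - (subdiv_htpy1 b c - subdiv_htpy1 a c + subdiv_htpy1 a b).
Proof.
rewrite /subdiv_htpy2 /subdiv2 /subdiv_htpy1 /= !(boundaryB, boundaryD) !boundary_asim3.
chain_ring.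
Qed.

End Vertices.

Lemma asim_ext_linear n (s : sing R S n) (E : normedModType R)
    (G : continuousType E S) (L : {linear 'rV[R]_n.+1 -> E}) m w :
  (forall x : simplex R n, s x = G (L (val x))) ->
  size w = m.+1 -> {in w, forall y, @simplex_set R n y} ->
  asim (ext s) m w = asim G m (map L w).
Proof.
move=> sL sw wP; apply/continuousEP => x.
pose y : simplex R n := exist _ (aff w (val x)) (mem_set (aff_simplex x sw wP)).
rewrite -[LHS]/(ext s (val y)) extE sL; congr (G _); exact: aff_linear.
Qed.

Lemma midpoint_simplex n (y z : 'rV[R]_n.+1) :
  @simplex_set R n y -> @simplex_set R n z -> @simplex_set R n (midpoint y z).
Proof.
move=> [y0 y1] [z0 z1]; split=> [i|]; first by rewrite !mxE mulr_ge0 // addr_ge0.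
under eq_bigr do rewrite !mxE; rewrite -mulr_sumr big_split /= y1 z1; lra.
Qed.

Lemma aff_is_linear (E : lmodType R) n (w : seq E) : linear (@aff R E n w).
Proof.
move=> k x y; rewrite /aff scaler_sumr -big_split; apply: eq_bigr => i _ /=.
by rewrite !mxE scalerDl scalerA.
Qed.

HB.instance Definition _ (E : lmodType R) n (w : seq E) :=
  GRing.isLinear.Build R _ _ _ (@aff R E n w) (aff_is_linear w).

Lemma aff_vtx_nth (E : lmodType R) n (w : seq E) i : (i < n.+1)%N ->
  aff w (vtx i : 'rV[R]_n.+1) = w`_i.
Proof.
move=> i_n; rewrite /aff (bigD1 (Ordinal i_n)) //= mxE eqxx scale1r big1 ?addr0 //.
move=> j ji; rewrite mxE; case: eqP => [jE|]; rewrite ?scale0r //.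
by rewrite -val_eqE /= jE eqxx in ji.
Qed.

Definition subdivide1 (c : chain R S 1) : chain R S 1 :=
  fglift (fun s : sing R S 1 => subdiv1 (ext s) (vtx 0) (vtx 1)) c.

Definition subdivide (c : chain R S 2) : chain R S 2 :=
  fglift (fun s : sing R S 2 => subdiv2 (ext s) (vtx 0) (vtx 1) (vtx 2)) c.

Definition subdivide_htpy1 (c : chain R S 1) : chain R S 2 :=
  fglift (fun s : sing R S 1 => subdiv_htpy1 (ext s) (vtx 0) (vtx 1)) c.

Definition subdivide_htpy (c : chain R S 2) : chain R S 3 :=
  fglift (fun s : sing R S 2 => subdiv_htpy2 (ext s) (vtx 0) (vtx 1) (vtx 2)) c.

Section Edges.
Variables (s : sing R S 2) (i : 'I_3).

Lemma asim_edge m w : size w = m.+1 -> {in w, forall y, @simplex_set R 1 y} ->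
  asim (ext (s \o face R i : sing R S 1)) m w = asim (ext s) m (map (face_vec i) w).
Proof.
apply: (@asim_ext_linear _ _ _ _ (@face_vec R 1 i)) => x.
by rewrite -[RHS]/(ext s (val (face R i x))) extE.
Qed.

Lemma subdiv1_edge : subdiv1 (ext (s \o face R i : sing R S 1)) (vtx 0) (vtx 1) =
  subdiv1 (ext s) (vtx (bump i 0)) (vtx (bump i 1)).
Proof.
rewrite /subdiv1 /= !asim_edge //= ?(midpoint_linear (@face_vec R 1 i)) /= ?face_vec_vtx //.
all: move=> y; rewrite !inE => /orP[] /eqP ->; try apply: midpoint_simplex.
all: exact: vtx_simplex.
Qed.

Lemma subdiv_htpy1_edge : subdiv_htpy1 (ext (s \o face R i : sing R S 1)) (vtx 0) (vtx 1) =
  subdiv_htpy1 (ext s) (vtx (bump i 0)) (vtx (bump i 1)).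
Proof.
rewrite /subdiv_htpy1 asim_edge //= ?(midpoint_linear (@face_vec R 1 i)) /= ?face_vec_vtx //.
move=> y; rewrite !inE => /or3P[] /eqP ->; [exact: vtx_simplex| |exact: vtx_simplex].
by apply: midpoint_simplex; exact: vtx_simplex.
Qed.

End Edges.

Lemma boundary_subdivide (c : chain R S 2) :
  boundary (subdivide c) = subdivide1 (boundary c).
Proof.
apply: (@additive_freeg_ext _ _ (fun c => boundary (subdivide c))
  (fun c => subdivide1 (boundary c))) => [x y|x y|s].
- by rewrite /subdivide fgliftB boundaryB.
- by rewrite boundaryB /subdivide1 fgliftB.
rewrite /subdivide fgliftU1 boundary_subdiv2 boundary_sing2 /subdivide1.
by rewrite fgliftD fgliftB !fgliftU1 !subdiv1_edge.
Qed.

Lemma boundary_subdivide_htpy (c : chain R S 2) :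
  boundary (subdivide_htpy c) = subdivide c - c - subdivide_htpy1 (boundary c).
Proof.
apply: (@additive_freeg_ext _ _ (fun c => boundary (subdivide_htpy c))
  (fun c => subdivide c - c - subdivide_htpy1 (boundary c))) => [x y|x y|s].
- by rewrite /subdivide_htpy fgliftB boundaryB.
- rewrite /subdivide /subdivide_htpy1 boundaryB !fgliftB; chain_ring.
rewrite /subdivide_htpy /subdivide fgliftU1 boundary_subdiv_htpy2.
rewrite boundary_sing2 /subdivide_htpy1.
rewrite fgliftD fgliftB !fgliftU1 !subdiv_htpy1_edge; congr (_ - _ - _).
by rewrite -[in RHS](asim_ext s).
Qed.

Lemma iter_subdivide (z : chain R S 2) k : boundary z = 0 ->
  boundary (iter k subdivide z) = 0 /\
  exists w, iter k subdivide z = z + boundary w.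
Proof.
move=> z0; elim: k => [|k [IHk [w IHw]]] /=.
  by split=> //; exists 0; rewrite /boundary fglift0 addr0.
split; first by rewrite boundary_subdivide IHk /subdivide1 fglift0.
exists (w + subdivide_htpy (iter k subdivide z)).
rewrite boundaryD boundary_subdivide_htpy IHk /subdivide_htpy1 fglift0 subr0.
by rewrite addrA -IHw subrKC.
Qed.

(** Affine pieces of [G] are subdivided into affine pieces of the same [G], so iterated subdivisions
    can be measured in the original simplex. *)
Lemma subdiv2_asim (E : normedModType R) (G : continuousType E S) a b c :
  subdiv2 (ext (asim G 2 [:: a; b; c])) (vtx 0) (vtx 1) (vtx 2) = subdiv2 G a b c.
Proof.
pose L := @aff R E 2 [:: a; b; c].
rewrite /subdiv2 /= !(@asim_ext_linear 2 _ E G L) //= ?(midpoint_linear L) /= ?aff_vtx_nth //.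
all: move=> y; rewrite !inE => /or3P[] /eqP ->; try apply: midpoint_simplex.
all: exact: vtx_simplex.
Qed.

Section Mesh.
Variable G : continuousType 'rV[R]_3 S.
Implicit Types a b c : 'rV[R]_3.

Definition mesh_le (d : R) (t : sing R S 2) := exists a b c,
  [/\ t = asim G 2 [:: a; b; c],
      [/\ @simplex_set R 2 a, @simplex_set R 2 b & @simplex_set R 2 c] &
      [/\ `|a - b| <= d, `|a - c| <= d & `|b - c| <= d]].

(** Every edge of a new triangle is, as a vector, half of an edge of the old one. *)
Lemma mesh_subdiv2 d t u : mesh_le d t ->
  u \in dom (subdiv2 (ext t) (vtx 0) (vtx 1) (vtx 2)) -> mesh_le (d / 2) u.
Proof.
move=> [a [b [c [-> [aP bP cP] [ab ac bc]]]]]; rewrite subdiv2_asim.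
have half (x y w : 'rV[R]_3) : `|x - y| <= d -> w = 2^-1 *: (x - y) -> `|w| <= d / 2.
  by move=> xy ->; rewrite normrZ gtr0_norm ?invr_gt0 // mulrC ler_pM2r ?invr_gt0.
have midl (x y : 'rV[R]_3) : x - midpoint x y = 2^-1 *: (x - y).
  by apply/rowP => i; rewrite !mxE; lra.
have midr (x y : 'rV[R]_3) : midpoint x y - y = 2^-1 *: (x - y).
  by apply/rowP => i; rewrite !mxE; lra.
have mab_mac : midpoint a b - midpoint a c = 2^-1 *: (b - c).
  by apply/rowP => i; rewrite !mxE; lra.
have mab_mbc : midpoint a b - midpoint b c = 2^-1 *: (a - c).
  by apply/rowP => i; rewrite !mxE; lra.
have mac_mbc : midpoint a c - midpoint b c = 2^-1 *: (a - b).
  by apply/rowP => i; rewrite !mxE; lra.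
move=> /domB; rewrite mem_cat => /orP[/domD_subset|]; last first.
  rewrite domU1 inE => /eqP ->; exists (midpoint a b), (midpoint a c), (midpoint b c).
  split=> //; split; try exact: midpoint_simplex.
  - exact: half bc mab_mac.
  - exact: half ac mab_mbc.
  - exact: half ab mac_mbc.
rewrite mem_cat => /orP[/domD_subset|]; last first.
  rewrite domU1 inE => /eqP ->; exists (midpoint a c), (midpoint b c), c.
  split=> //; split => //; try exact: midpoint_simplex.
  - exact: half ab mac_mbc.
  - exact: half ac (midr a c).
  - exact: half bc (midr b c).
rewrite mem_cat => /orP[|]; rewrite domU1 inE => /eqP ->.
  exists a, (midpoint a b), (midpoint a c).
  split=> //; split => //; try exact: midpoint_simplex.
  - exact: half ab (midl a b).
  - exact: half ac (midl a c).
  - exact: half bc mab_mac.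
exists (midpoint a b), b, (midpoint b c).
split=> //; split => //; try exact: midpoint_simplex.
- exact: half ab (midr a b).
- exact: half ac mab_mbc.
- exact: half bc (midl b c).
Qed.

Lemma mesh_image d t : mesh_le d t ->
  exists2 a, @simplex_set R 2 a & forall x, exists2 y, `|a - y| <= d & t x = G y.
Proof.
move=> [a [b [c [-> [aP bP cP] [ab ac bc]]]]]; exists a => // x.
exists (aff [:: a; b; c] (val x)) => //.
have [x0 x1] := set_valP x; have d0 : 0 <= d by apply: le_trans ab.
rewrite -[a in a - _]scale1r -[1]x1 /aff scaler_suml -sumrB.
apply: le_trans (ler_norm_sum _ _ _) _.
rewrite -[leRHS]mul1r -x1 mulr_suml; apply: ler_sum => i _.
rewrite -scalerBr normrZ ger0_norm ?x0 // ler_wpM2l ?x0 //.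
case: i => -[|[|[|//]]] i3 //=; first by rewrite subrr normr0.
Qed.

End Mesh.

Definition edge_length : R := `|vtx 0 - vtx 1 : 'rV[R]_3| +
  `|vtx 0 - vtx 2 : 'rV[R]_3| + `|vtx 1 - vtx 2 : 'rV[R]_3|.

Lemma mesh_iter (z : chain R S 2) k t : t \in dom (iter k subdivide z) ->
  exists2 s, s \in dom z & mesh_le (ext s) (edge_length / 2 ^+ k) t.
Proof.
elim: k t => [|k IHk] t /=.
  move=> tz; exists t => //; exists (vtx 0), (vtx 1), (vtx 2); split.
  - by rewrite -[LHS](asim_ext t).
  - by split; exact: vtx_simplex.
  rewrite expr0 divr1 /edge_length.
  set x := `|_|; set y := `|_|; set w := `|_|.
  have x0 : 0 <= x by exact: normr_ge0.
  have y0 : 0 <= y by exact: normr_ge0.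
  have w0 : 0 <= w by exact: normr_ge0.
  by split; lra.
move=> /mem_dom_fglift[u /IHk[s sz su] tu]; exists s => //.
by rewrite exprSr invfM mulrA; exact: mesh_subdiv2 su tu.
Qed.

(** A Lebesgue number argument, carried out in a compact cube that contains the standard simplex. *)
Lemma small_simplices (good : set S -> Prop) (z : chain R S 2) :
  (forall p, exists O, [/\ open O, O p & good O]) -> boundary z = 0 ->
  exists z' w, [/\ boundary z' = 0, z' = z + boundary w &
    forall t, t \in dom z' -> exists2 O, good O & forall x, O (t x)].
Proof.
move=> cover z0.
(* The ball around [a] whose radius bounds the mesh after [k] subdivisions is sent into a single
   good set. *)
pose Q (s : sing R S 2) k (a : 'rV[R]_3) := exists2 O, good O &
  forall y, `|a - y| <= edge_length / 2 ^+ k -> O (ext s y).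
pose cube := [set a : 'rV[R]_3 | forall i, `[0, 1]%classic (a ord0 i)].
have L0 : 0 <= edge_length by rewrite !addr_ge0 ?normr_ge0.
have near_s s : \forall k \near \oo, cube `<=` Q s k.
  have /compact_near_coveringP cc : compact cube.
    by apply: (@rV_compact R 3 (fun=> `[0, 1]%classic)) => i; exact: segment_compact.
  apply: (cc nat \oo (Q s)).
  move=> a _; have [W [oW Wa gW]] := cover (ext s a).
  have /nbhs_normP[e /= e0 eO] : nbhs a (ext s @^-1` W).
    by apply: (cts_fun a); exact: open_nbhs_nbhs.
  have e2 : 0 < e / 2 by rewrite divr_gt0.
  have small : \forall k \near \oo, edge_length / 2 ^+ k < e / 2.
    have e3 : 0 < e / 2 / (edge_length + 1) by rewrite divr_gt0 // ltr_wpDl.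
    have := near_infty_natSinv_expn_lt (PosNum e3); apply: filterS => k /=.
    rewrite ltr_pdivlMr ?ltr_wpDl // => h; apply: le_lt_trans h.
    by rewrite mul1r mulrC ler_wpM2l ?invr_ge0 ?exprn_ge0 // lerDl.
  near=> a' k; exists W => // y ya; apply: eO.
  have aa' : `|a - a'| < e / 2 by near: a'; exact: cvgr_dist_lt.
  have k2 : edge_length / 2 ^+ k < e / 2 by near: k; exact: small.
  rewrite /= (splitr e) -(subrKA a').
  by apply: le_lt_trans (ler_normD _ _) (ltrD aa' (le_lt_trans ya k2)).
(* [dom z] is finite, so one [k] works for all its simplices. *)
have near_z : \forall k \near \oo, forall s, s \in dom z -> cube `<=` Q s k.
  elim: (dom z) => [|s l IHl]; first by near=> k.
  apply: filterS2 (near_s s) IHl => k Hs Hl u; rewrite inE => /orP[/eqP ->|] //.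
  exact: Hl.
have [k Hk] := filter_ex near_z.
have [z'0 [w z'E]] := iter_subdivide k z0.
exists (iter k subdivide z), w; split=> // t /mesh_iter[s sz /mesh_image[a aP ta]].
have [|W gW HW] := Hk s sz a.
  move=> i; have [a0 a1] := aP; rewrite /= in_itv /= a0 -a1 (bigD1 i) //= lerDl.
  exact: sumr_ge0.
by exists W => // x; have [y ya ->] := ta x; exact: HW.
Unshelve. all: by end_near. Qed.

End Subdivision.

(** * Straightening in the annulus *)

Section ContinuityExtra.
Context (R : realType).

Lemma continuous_compo (T U V : topologicalType) (f : T -> U) (g : U -> V) :
  continuous f -> continuous g -> continuous (fun t => g (f t)).
Proof. by move=> cf cg t; apply: continuous_comp; [exact: cf|exact: cg]. Qed.

Lemma continuous_fst_compo (T U V : topologicalType) (f : T -> V) :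
  continuous f -> continuous (fun p : T * U => f p.1).
Proof. by move=> cf; apply: continuous_compo cf => p; exact: cvg_fst. Qed.

Lemma continuous_snd_compo (T U V : topologicalType) (f : U -> V) :
  continuous f -> continuous (fun p : T * U => f p.2).
Proof. by move=> cf; apply: continuous_compo cf => p; exact: cvg_snd. Qed.

Definition clamp (x : R) : R := Num.max 0 (Num.min 1 x).

Lemma clampP x : 0 <= clamp x <= 1.
Proof. by rewrite /clamp le_max lexx ge_max ler01 ge_min lexx. Qed.

Lemma clamp_id x : 0 <= x <= 1 -> clamp x = x.
Proof.
by rewrite /clamp => /andP[x0 x1]; rewrite (min_idPr x1) (max_idPr x0).
Qed.

Lemma clamp0 x : x <= 0 -> clamp x = 0.
Proof. by move=> x0; rewrite /clamp; apply/max_idPl; rewrite ge_min x0 orbT. Qed.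

Lemma clamp1 x : 1 <= x -> clamp x = 1.
Proof. by move=> x1; rewrite /clamp (min_idPl x1); apply/max_idPr. Qed.

Lemma continuous_clamp : continuous clamp.
Proof.
apply: continuous_maxr; first exact: cst_continuous.
by apply: continuous_minr; [exact: cst_continuous|move=> x; exact: cvg_id].
Qed.

(* Constant near both ends of [0, 1], so that the twist it defines is the
   identity near the boundary of the annulus, unlike the linear twist of
   [twist_map]. *)
Definition profile (t : R) : R := clamp (2 * t - 2^-1).

Lemma profile0 t : t <= 4^-1 -> profile t = 0.
Proof. by move=> t4; apply: clamp0; lra. Qed.

Lemma profile1 t : 3 / 4 <= t -> profile t = 1.
Proof. by move=> t4; apply: clamp1; lra. Qed.

Lemma continuous_profile : continuous profile.
Proof.
apply: continuous_compo continuous_clamp.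
apply: continuous_sub; last exact: cst_continuous.
by apply: continuous_mul; [exact: cst_continuous|move=> x; exact: cvg_id].
Qed.

Lemma small_intr_eq0 (k : int) : `|k%:~R : R| < 1 -> k = 0.
Proof. by rewrite -intr_norm -[1]/(1%:~R) ltr_int; lia. Qed.

End ContinuityExtra.

Section Straightening.
Context (R : realType) (S : topologicalType).
(** Over heights in [[0, 1]] this is the universal cover of the annulus: the first coordinate is the
    angle in full turns, and its integer translations are the deck transformations. *)
Variable Phi : continuousType (R^o * R^o)%type S.
Hypothesis Phi_period : forall (a t : R) (k : int), Phi (a + k%:~R, t) = Phi (a, t).
Hypothesis Phi_inj : forall a b t u : R, 0 <= t <= 1 -> 0 <= u <= 1 ->
  Phi (a, t) = Phi (b, u) -> t = u /\ exists k : int, a = b + k%:~R.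

Lemma barycenter_shift n (x : simplex R n) (f g : 'I_n.+1 -> R) c :
  (forall i, f i = g i + c) ->
  \sum_i val x 0 i * f i = \sum_i val x 0 i * g i + c.
Proof.
move=> fg; have [_ x1] := set_valP x.
under eq_bigr do rewrite fg mulrDr.
by rewrite big_split -mulr_suml x1 mul1r.
Qed.

Definition vert n (i : 'I_n.+1) : simplex R n :=
  exist _ (vtx i) (mem_set (vtx_simplex R (ltn_ord i))).

Lemma face_vert n (i : 'I_n.+2) (j : 'I_n.+1) :
  face R i (vert j) = vert (fintype.lift i j).
Proof. by apply: val_inj; rewrite /= face_vec_vtx. Qed.

(** Angular variation below 1/2 makes the lift unique up to one integer; vertical variation below
    1/2 prevents a simplex from reaching both [t <= 1/4] and [t >= 3/4]. *)
Definition is_lift n (s : sing R S n) (th t : simplex R n -> R) :=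
  [/\ continuous th /\ continuous t, forall x, 0 <= t x <= 1,
      forall x, s x = Phi (th x, t x),
      forall x y, `|th x - th y| < 2^-1 & forall x y, `|t x - t y| < 2^-1].

Lemma is_lift_face n (s : sing R S n.+1) th t (i : 'I_n.+2) :
  is_lift s th t ->
  is_lift (s \o face R i : sing R S n) (th \o face R i) (t \o face R i).
Proof.
move=> [[cth ct] t01 sE th2 t2]; split=> [|x|x|x y|x y] /=.
- by split; apply: continuous_compo => //; exact: cts_fun.
- exact: t01.
- exact: sE.
- exact: th2.
- exact: t2.
Qed.

Section Homotopy.
Variables (n : nat) (th t : simplex R n -> R).

Definition base (i : 'I_n.+1) : int := Num.floor (th (vert i)).
Definition side (i : 'I_n.+1) : int := (2^-1 <= t (vert i))%R.
(* Integer positions in the universal cover of the annulus: [side] records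
   whether the m-fold twist moves the vertex by m turns. *)
Definition code (m : nat) i : int := base i + m%:Z * side i.

(** Straight lines in the universal cover, from the twisted simplex at time 0 to the affine simplex
    with integer vertices [code] on the core circle at time 1. *)
Definition straight_angle m (p : simplex R n * R^o) : R :=
  (1 - p.2) * (th p.1 + m%:R * profile (t p.1))
  + p.2 * \sum_i val p.1 0 i * (code m i)%:~R.

Definition straight_height (p : simplex R n * R^o) : R :=
  (1 - p.2) * t p.1 + p.2 * 2^-1.

Hypotheses (cth : continuous th) (ct : continuous t).

Lemma straight_continuous m :
  continuous (fun p => Phi (straight_angle m p, straight_height p)).
Proof.
have c1 : continuous (fun p : simplex R n * R^o => 1 - p.2 : R).
  by apply: continuous_sub; [exact: cst_continuous|move=> p; exact: cvg_snd].
have c2 : continuous (fun p : simplex R n * R^o => p.2 : R) by move=> p; exact: cvg_snd.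
have c3 : continuous (fun p : simplex R n * R^o => t p.1) by exact: continuous_fst_compo.
apply: (@continuous_compo _ _ _
  (fun p => (straight_angle m p : R^o, straight_height p : R^o)) Phi);
  last exact: cts_fun.
apply: continuous_pair; apply: continuous_add.
- apply: continuous_mul => //; apply: continuous_add; first exact: continuous_fst_compo.
  apply: continuous_mul; first exact: cst_continuous.
  exact: continuous_compo c3 (@continuous_profile R).
- apply: continuous_mul => //; apply: (@continuous_sumr R _ R^o) => i.
  apply: continuous_mul; last exact: cst_continuous.
  apply: (@continuous_fst_compo _ _ _ (fun x : simplex R n => val x 0 i)).
  by apply: continuous_compo (@coord_continuous R _ _ 0 i); exact: continuous_val_simplex.
- exact: continuous_mul.
- by apply: continuous_mul => //; exact: cst_continuous.
Qed.

Definition straightening m : continuousType (simplex R n * R^o)%type S :=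
  mkcts (@straight_continuous m).

End Homotopy.

Lemma straightening_face n (th t : simplex R n.+1 -> R)
    (cth : continuous th) (ct : continuous t) (i : 'I_n.+2)
    (cthi : continuous (th \o face R i)) (cti : continuous (t \o face R i)) m :
  cylinder_face (straightening cth ct m) i = straightening cthi cti m.
Proof.
apply/continuousEP => -[x s]; rewrite -[LHS]/(Phi (_, _)) -[RHS]/(Phi (_, _)).
congr (Phi (_ + _ * _, _)); rewrite (bigD1_ord i) //= mxE unlift_none mul0r add0r.
by apply: eq_bigr => j _; rewrite mxE liftK /= /code /base /side /= !face_vert.
Qed.

(** The angles of two lifts differ by an integer at each point, and this integer varies by less than
    1, hence not at all. *)
Lemma is_lift_unique n (s : sing R S n) th t th' t' :
  is_lift s th t -> is_lift s th' t' ->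
  t = t' /\ exists k : int, forall x, th x = th' x + k%:~R.
Proof.
move=> [_ t01 sE th2 t2] [_ t'01 s'E th'2 t'2].
have H x : t x = t' x /\ exists k : int, th x = th' x + k%:~R.
  by apply: Phi_inj => //; rewrite -sE -s'E.
split; first by apply/funext => x; have [] := H x.
have [_ [k kE]] := H (vert ord0); exists k => x; have [_ [l lE]] := H x.
suff -> : k = l by [].
apply/eqP; rewrite -subr_eq0; apply/eqP/(@small_intr_eq0 R); rewrite intrB.
have := th2 (vert ord0) x; have := th'2 (vert ord0) x.
rewrite kE lE !ltr_norml => /andP[? ?] /andP[? ?]; apply/andP; split; lra.
Qed.

(** A deck translation moves the angle and the integer vertices by the same [k]. *)
Lemma straightening_shift n (th t th' : simplex R n -> R)
    (cth : continuous th) (ct : continuous t) (cth' : continuous th') (k : int) m :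
  (forall x, th x = th' x + k%:~R) ->
  straightening cth ct m = straightening cth' ct m.
Proof.
move=> thE; apply/continuousEP => -[x s]; rewrite -[LHS]/(Phi (_, _)).
rewrite -[RHS](Phi_period _ _ k); congr (Phi (_, _)).
rewrite /straight_angle /= (@barycenter_shift _ _ _ (fun i => (code th' t m i)%:~R) k%:~R).
  by rewrite thE; ring.
move=> i; rewrite -intrD; congr (_%:~R).
by rewrite /code /base thE floorDrz ?intr_int // intrKfloor addrAC.
Qed.

Definition loop_map (x : R^o) : S := Phi (x, 2^-1 : R^o).

Lemma loop_continuous : continuous loop_map.
Proof.
apply: (@continuous_compo _ _ _ (fun x : R^o => (x, 2^-1 : R^o)) Phi); last exact: cts_fun.
by apply: continuous_pair => x; [exact: cvg_id|exact: cst_continuous].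
Qed.

Definition loop : continuousType R^o S := mkcts loop_continuous.

(* The simplex [p|q] of the bar complex of Z, wrapped around the core circle. *)
Definition bar (p q : int) : chain R S 2 :=
  << asim loop 2 [:: 0; p%:~R; (p + q)%:~R] >>.

Lemma asim_loop_shift n (w : seq R^o) (k : int) : size w = n.+1 ->
  asim loop n [seq x + k%:~R | x <- w] = asim loop n w.
Proof.
move=> sw; apply/continuousEP => x; rewrite -[RHS](Phi_period _ _ k).
congr (Phi (_, _)); apply: barycenter_shift => i.
by rewrite (nth_map 0) ?sw.
Qed.

(** Passage from the homogeneous to the inhomogeneous notation of the bar complex, by a common deck
    translation of the vertices. *)
Lemma bar_triple (a b c : int) :
  << asim loop 2 [:: a%:~R; b%:~R; c%:~R] >> = bar (b - a) (c - b).
Proof.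
rewrite /bar -[in RHS](@asim_loop_shift 2 _ a) //=; congr << asim _ _ _ >>.
by congr [:: _; _; _]; rewrite ?add0r // -intrD; congr (_%:~R); lia.
Qed.

Lemma bar_cocycle p q s :
  fills 1 (bar q s - bar (p + q) s + bar p (q + s) - bar p q).
Proof.
have := fills_boundaryU (asim loop 3 [:: 0%:~R; p%:~R; (p + q)%:~R; (p + q + s)%:~R]).
rewrite boundary_asim3 !bar_triple.
by congr (fills _ (bar _ _ - bar _ _ + bar _ _ - bar _ _)); lia.
Qed.

Section EdgeTerm.
Variables (th t : simplex R 1 -> R) (cth : continuous th) (ct : continuous t).

(** Joins the algebraic contribution of an edge, from [split_chainP], to the geometric one, the side
    of a prism. *)
Definition edge_term m : chain R S 2 :=
  split_chain bar m (base th 1 - base th 0) (side t 1 - side t 0)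
  - cyl_prism1 (straightening cth ct m).

End EdgeTerm.

(* The lift is chosen; any other one gives the same value (correctionE). Edges
   without a lift get 0, the value that liftable edges near the boundary of the
   annulus have anyway (correction_near_boundary). *)
Definition correction (m : nat) (e : sing R S 1) : chain R S 2 :=
  xget 0 [set c | exists th t (cth : continuous th) (ct : continuous t),
    is_lift e th t /\ c = edge_term cth ct m - edge_term cth ct 0].

Lemma correctionE m (e : sing R S 1) th t (cth : continuous th) (ct : continuous t) :
  is_lift e th t -> correction m e = edge_term cth ct m - edge_term cth ct 0.
Proof.
move=> et; rewrite /correction.
case: xgetP => [c _|/(_ (edge_term cth ct m - edge_term cth ct 0))[]]; last first.
  by exists th, t, cth, ct.
move=> [th' [t' [cth' [ct' [et' ->]]]]].
have [tE [k thE]] := is_lift_unique et' et; subst t'.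
have E j : edge_term cth' ct' j = edge_term cth ct j.
  rewrite /edge_term (straightening_shift cth' ct' cth _ thE).
  rewrite (Prop_irrelevance ct' ct); congr (split_chain _ _ _ _ - _).
  by rewrite /base !thE !floorDrz ?intr_int // !intrKfloor opprD addrACA subrr addr0.
by rewrite !E.
Qed.

(** At these heights [profile] is 0 or 1, so the twist fixes the simplex pointwise; the simplex may
    also leave the annulus. *)
Definition near_boundary n (s : sing R S n) := forall x a t, 0 <= t <= 1 ->
  s x = Phi (a, t) -> t <= 4^-1 \/ 3 / 4 <= t.

(** Small height variation keeps a lifted edge on one side, so all its angles and codes move by the
    same integer, [0] or [m], a deck translation. This makes the corrections of lifted triangles
    compatible with the value 0 near the boundary. *)
Lemma correction_near_boundary m (e : sing R S 1) :
  near_boundary e -> correction m e = 0.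
Proof.
move=> eb; rewrite /correction; case: xgetP => [c _ [th [t [cth [ct [et ->]]]]]|//].
have [_ t01 eE th2 t2] := et.
have [d [d01 [sd pd]]] : exists d : int, 0 <= d <= 1 /\
    ((forall i, side t i = d) /\ (forall x, profile (t x) = d%:~R)).
  have [t4|t4] := eb _ _ _ (t01 (vert ord0)) (eE (vert ord0)).
    have tx x : t x <= 4^-1.
      have := t2 (vert ord0) x; rewrite ltr_norml => /andP[? _].
      by have [//|] := eb _ _ _ (t01 x) (eE x); lra.
    exists 0; split=> //; split=> [i|x]; last exact: profile0.
    rewrite /side (_ : (_ <= _) = false) //; apply/negbTE; rewrite -ltNge.
    by have := tx (vert i); lra.
  have tx x : 3 / 4 <= t x.
    have := t2 (vert ord0) x; rewrite ltr_norml => /andP[_ ?].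
    by have [|//] := eb _ _ _ (t01 x) (eE x); lra.
  exists 1; split=> //; split=> [i|x]; last exact: profile1.
  by rewrite /side (_ : (_ <= _) = true) //; have := tx (vert i); lra.
apply/eqP; rewrite subr_eq0; apply/eqP; rewrite /edge_term !sd subrr split_chain0.
congr (_ - cyl_prism1 _); apply/continuousEP => -[x s].
rewrite -[RHS](Phi_period _ _ (m%:Z * d)); congr (Phi (_, _)).
rewrite /straight_angle /= pd.
rewrite (@barycenter_shift _ _ _ (fun i => (code th t 0 i)%:~R) (m%:Z * d)%:~R).
  by rewrite intrM -pmulrn; ring.
by move=> i; rewrite -intrD /code !sd mul0r addr0.
Qed.

Lemma negl_at0 (r : nat -> nat) n (c : nat -> chain R S n) :
  (forall m, (0 < r m)%N) -> negl r c -> negl r (fun=> c 0%N).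
Proof. by move=> r0 [K HK]; apply: (@negl_bounded _ _ _ _ r0 (K * r 0%N)). Qed.

(** A prism straightens the twisted simplex to a bar simplex, which [split_chainP] splits into edge
    terms. Subtracting the same relations at [m = 0], where [u 0 = s], brings in [s]. *)
Lemma twist_negl (s : sing R S 2) th t (u : nat -> sing R S 2) :
  is_lift s th t ->
  (forall m x, u m x = Phi (th x + m%:R * profile (t x), t x)) ->
  negl root_rate (fun m => << u m >> - << s >> - fglift (correction m) (boundary << s >>)).
Proof.
move=> st uE; have [[cth ct] t01 sE _ _] := st.
have cf i : continuous (th \o face R i) /\ continuous (t \o face R i).
  by have [] := is_lift_face i st.
pose b i j : int := base th j - base th i; pose d i j : int := side t j - side t i.
pose T m := << slice (straightening cth ct m) 1 >> : chain R S 2.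
pose P m i := cyl_prism1 (straightening (cf i).1 (cf i).2 m) : chain R S 2.
have uS m : u m = slice (straightening cth ct m) 0.
  apply/continuousEP => x; rewrite uE -[RHS]/(Phi (_, _)); congr (Phi (_, _)).
    by rewrite /straight_angle /=; ring.
  by rewrite /straight_height /=; ring.
have s0 : s = u 0%N by apply/continuousEP => x; rewrite uE sE mul0r addr0.
have TE m : T m = bar (b 0 1 + m%:Z * d 0 1) (b 1 2%:R + m%:Z * d 1 2%:R).
  pose w := [:: (code th t m 0)%:~R : R^o; (code th t m 1)%:~R; (code th t m 2%:R)%:~R].
  transitivity (<< asim loop 2 w >> : chain R S 2).
    congr << _ >>; apply/continuousEP => x; rewrite -[LHS]/(Phi (_, _)) -[RHS]/(Phi (_, _)).
    congr (Phi (_, _)); last by rewrite /straight_height /=; ring.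
    rewrite /straight_angle /= subrr mul0r add0r mul1r; apply: eq_bigr => i _.
    by case: i => -[|[|[|//]]] i3; congr (_ * _) => /=;
      congr (code _ _ _ _)%:~R; exact: val_inj.
  by rewrite bar_triple /code /b /d; congr (bar _ _); ring.
have fP m := fills_cyl_prism2 (straightening cth ct m).
have cE m i : correction m (s \o face R i : sing R S 1) =
    let bi := b (fintype.lift i 0) (fintype.lift i 1) in
    let di := d (fintype.lift i 0) (fintype.lift i 1) in
    split_chain bar m bi di - split_chain bar 0 bi di - (P m i - P 0%N i).
  rewrite (correctionE m (cf i).1 (cf i).2 (is_lift_face i st)) /edge_term /P.
  rewrite /base /side /= !face_vert; chain_ring.
have FP : negl root_rate (fun m => T m - << u m >> - (P m 0 - P m 1 + P m 2%:R)).
  apply: (@negl_bounded _ _ _ _ _ 3) => // m; rewrite uS /P.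
  by rewrite -!(straightening_face cth ct); exact: fP.
have Q := split_chainP bar_cocycle (b 0 1) (d 0 1) (b 1 2%:R) (d 1 2%:R).
have [l00 l01] : fintype.lift 0 0 = 1 :> 'I_3 /\ fintype.lift 0 1 = 2%:R :> 'I_3.
  by split; exact: val_inj.
have [l10 l11] : fintype.lift 1 0 = 0 :> 'I_3 /\ fintype.lift 1 1 = 2%:R :> 'I_3.
  by split; exact: val_inj.
have [l20 l21] : fintype.lift 2%:R 0 = 0 :> 'I_3 /\ fintype.lift 2%:R 1 = 1 :> 'I_3.
  by split; exact: val_inj.
have bD : b 0 1 + b 1 2%:R = b 0 2%:R by rewrite /b addrC subrKA.
have dD : d 0 1 + d 1 2%:R = d 0 2%:R by rewrite /d addrC subrKA.
have r0 m : (0 < root_rate m)%N by [].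
apply: negl_ext (neglB (neglB Q (negl_at0 r0 Q)) (neglB FP (negl_at0 r0 FP))) => m.
rewrite boundary_sing2 fgliftD fgliftB !fgliftU1 !cE !TE s0.
rewrite l00 l01 l10 l11 l20 l21 bD dD; chain_ring.
Qed.

End Straightening.

(** * The twist and its powers *)

Section Topology.

Lemma hausdorff_pair (T U : topologicalType) :
  hausdorff_space T -> hausdorff_space U -> hausdorff_space (T * U)%type.
Proof.
move=> hT hU [a b] [c d] abcd; congr pair.
  apply: hT => A B Aa Bc; have [] := abcd (A `*` setT) (B `*` setT).
  - by exists (A, setT) => //; split=> //; exact: filterT.
  - by exists (B, setT) => //; split=> //; exact: filterT.
  by move=> [x y] [[/= Ax _] [/= Bx _]]; exists x.
apply: hU => A B Ab Bd; have [] := abcd (setT `*` A) (setT `*` B).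
- by exists (setT, A) => //; split=> //; exact: filterT.
- by exists (setT, B) => //; split=> //; exact: filterT.
by move=> [x y] [[/= _ Ay] [/= _ By]]; exists y.
Qed.

Lemma closed_preimage (T U : topologicalType) (f : T -> U) (D : set U) :
  continuous f -> closed D -> closed (f @^-1` D).
Proof. by move=> cf; exact: (continuous_closedP f).1. Qed.

Lemma compact_image (T U : topologicalType) (f : T -> U) (C : set T) :
  continuous f -> compact C -> compact (f @` C).
Proof.
by move=> cf; apply: continuous_compact; exact: continuous_subspaceT.
Qed.

Lemma compact_capr (T : topologicalType) (C D : set T) :
  compact C -> closed C -> closed D -> compact (C `&` D).
Proof.
move=> cC clC clD; apply: (subclosed_compact _ cC); last by move=> x [].
exact: closedI.
Qed.

(** A continuous injection of a compact set into a Hausdorff space is closed, so preimages of closed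
    sets under [g] are preimages of closed sets under [k \o g]. *)
Lemma continuous_lift (X P Y : topologicalType) (k : P -> Y) (C : set P)
    (g : X -> P) :
  hausdorff_space Y -> continuous k -> compact C -> closed C ->
  {in C &, injective k} -> (forall x, C (g x)) ->
  continuous (fun x => k (g x)) -> continuous g.
Proof.
move=> hY ck cC clC kI Cg ckg; apply/continuous_closedP => D clD.
have -> : g @^-1` D = (fun x => k (g x)) @^-1` (k @` (C `&` D)).
  apply/seteqP; split=> x /=; first by exists (g x).
  by move=> [p [Cp Dp] /kI <-] //; exact/mem_set.
apply: closed_preimage => //; apply: compact_closed => //.
by apply: compact_image => //; exact: compact_capr.
Qed.

End Topology.

(** * The circle and the universal cover of the annulus *)

Section Circle.
Context (R : realType).

Lemma cos_eq1 (x : R) : `|x| <= pi -> cos x = 1 -> x = 0.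
Proof.
move=> xpi cx; apply/normr0_eq0/(@cos_inj R).
- by rewrite in_itv /= normr_ge0.
- by rewrite in_itv /= lexx pi_ge0.
- by rewrite cos_norm cos0.
Qed.

Lemma cosD_int (x : R) (k : int) : cos (x + 2 * pi * k%:~R) = cos x.
Proof.
have H n y : cos (y + 2 * pi * n%:R) = cos y :> R.
  by rewrite mulr_natr mulr_natl; exact: (periodicn (@cosD2pi R)).
case: k => n; first exact: H.
by rewrite NegzE mulrNz -[x in RHS](subrK (2 * pi * n.+1%:R)) H mulrN.
Qed.

Lemma sinD_int (x : R) (k : int) : sin (x + 2 * pi * k%:~R) = sin x.
Proof.
have H n y : sin (y + 2 * pi * n%:R) = sin y :> R.
  by rewrite mulr_natr mulr_natl; exact: (periodicn (@sinD2pi R)).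
case: k => n; first exact: H.
by rewrite NegzE mulrNz -[x in RHS](subrK (2 * pi * n.+1%:R)) H mulrN.
Qed.

Lemma cis_period (a : R) (k : int) : cis (2 * pi * (a + k%:~R)) = cis (2 * pi * a).
Proof. by apply: val_inj; rewrite /= mulrDr cosD_int sinD_int. Qed.

Lemma cis_inj (a b : R) : cis (2 * pi * a) = cis (2 * pi * b) ->
  exists k : int, a = b + k%:~R.
Proof.
move=> /(congr1 val) /= [cab sab]; have pi0 := pi_gt0 R.
(* An integer nearest to [a - b]: the remainder times [2 pi] lies in [[- pi, pi]], where the cosine
   is 1 only at 0. *)
pose k := Num.floor (a - b + 2^-1); exists k.
have /andP[k1 k2] := floor_itv (a - b + 2^-1); rewrite -/k in k1 k2.
pose c := a - b - k%:~R; suff : c = 0 by rewrite /c; lra.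
suff : 2 * pi * c = 0 by move=> /eqP; rewrite !mulf_eq0 (gt_eqF pi0) pnatr_eq0 /= => /eqP.
apply: cos_eq1.
  rewrite intrD in k2; rewrite normrM gtr0_norm ?mulr_gt0 // mulrAC.
  rewrite ler_piMl ?(ltW pi0) //.
  have : `|c| <= 2^-1 by rewrite ler_norml /c; apply/andP; split; lra.
  lra.
have -> : 2 * pi * c = 2 * pi * a - 2 * pi * b + 2 * pi * (- k)%:~R.
  by rewrite /c intrN; ring.
by rewrite cosD_int cosB cab sab -!expr2 cos2Dsin2.
Qed.

Lemma cis_surj (p : circle R) : exists a : R, cis (2 * pi * a) = p.
Proof.
case: p => -[x y] pP; have xy : x ^+ 2 + y ^+ 2 = 1 by exact: (set_mem pP).
have pi0 := pi_gt0 R.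
have x1 : -1 <= x <= 1.
  rewrite -ler_norml -(@ler_sqr R) ?nnegrE // expr1n real_normK ?num_real //.
  by have := sqr_ge0 y; lra.
have ax : 2 * pi * (acos x / (2 * pi)) = acos x by rewrite mulrC divfK // gt_eqF // mulr_gt0.
have ys : `|y| = sin (acos x).
  rewrite sin_acos // -sqrtr_sqr; congr (Num.sqrt _); lra.
case: (leP 0 y) => y0.
  exists (acos x / (2 * pi)); apply: val_inj => /=; rewrite ax acosK ?in_itv //.
  by rewrite -ys ger0_norm.
exists (- (acos x / (2 * pi))); apply: val_inj => /=; rewrite mulrN ax.
by rewrite cosN sinN acosK ?in_itv // -ys ltr0_norm // opprK.
Qed.

Lemma continuous_cis (f : R^o -> R) : continuous f ->
  continuous (fun x => cis (f x) : circle R).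
Proof.
move=> cf; apply: continuous_comp_initial.
apply: (@continuous_pair _ _ _ (fun x => cos (f x)) (fun x => sin (f x))).
  exact: continuous_compo cf (@continuous_cos R).
exact: continuous_compo cf (@continuous_sin R).
Qed.

End Circle.

Section AnnulusChart.
Context (R : realType) (S : topologicalType).
Variable phi : circle R * unit_interval R -> S.
Hypothesis phi_continuous : continuous phi.
Hypothesis phi_inj : injective phi.

Lemma clamp_unit (x : R) : clamp x \in `[0 : R, 1]%classic.
Proof. by apply/mem_set; rewrite /= in_itv /= clampP. Qed.

Definition unit_of (x : R) : unit_interval R := exist _ (clamp x) (clamp_unit x).

Lemma continuous_unit_of (T : topologicalType) (f : T -> R) : continuous f ->
  continuous (fun x => unit_of (f x)).
Proof.
move=> cf; apply: continuous_comp_initial.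
exact: continuous_compo cf (@continuous_clamp R).
Qed.

Lemma unit_of_val (t : unit_interval R) : unit_of (val t) = t.
Proof.
apply: val_inj; have := set_valP t; rewrite /= in_itv /=; exact: clamp_id.
Qed.

(** [unit_of] clamps the height, so the chart is defined on the whole plane; the factor [2 * pi]
    makes its period 1. *)
Definition chart_map (p : R^o * R^o) : S := phi (cis (2 * pi * p.1), unit_of p.2).

Lemma chart_continuous : continuous chart_map.
Proof.
apply: (@continuous_compo _ _ _
  (fun p : R^o * R^o => (cis (2 * pi * p.1), unit_of p.2)) phi) => //.
apply: continuous_pair.
  apply: (@continuous_fst_compo _ _ _ (fun x : R^o => cis (2 * pi * x))).
  apply: continuous_cis; apply: continuous_mul; first exact: cst_continuous.
  by move=> x; exact: cvg_id.
by apply: continuous_unit_of => p; exact: cvg_snd.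
Qed.

Definition chart : continuousType (R^o * R^o)%type S := mkcts chart_continuous.

Lemma chart_period (a t : R) (k : int) : chart (a + k%:~R, t) = chart (a, t).
Proof. by rewrite -[LHS]/(phi (_, _)) /= cis_period. Qed.

Lemma chart_inj (a b t u : R) : 0 <= t <= 1 -> 0 <= u <= 1 ->
  chart (a, t) = chart (b, u) -> t = u /\ exists k : int, a = b + k%:~R.
Proof.
move=> t01 u01 /phi_inj E; split; last exact: cis_inj (congr1 fst E).
by have := congr1 (fun p => val p.2) E; rewrite /= !clamp_id.
Qed.

Lemma chart_surj p : exists a t : R, 0 <= t <= 1 /\ phi p = chart (a, t).
Proof.
case: p => c t; have [a <-] := cis_surj c; exists a, (val t).
split; first by have := set_valP t; rewrite /= in_itv.
by rewrite -[RHS]/(phi (_, _)) /= unit_of_val.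
Qed.

Definition box (a b c d : R) : set (R^o * R^o) := `[a, b]%classic `*` `[c, d]%classic.

Lemma compact_box a b c d : compact (box a b c d).
Proof. by apply: compact_setX; exact: segment_compact. Qed.

Hypothesis hS : hausdorff_space S.

Lemma closed_box a b c d : closed (box a b c d).
Proof.
apply: compact_closed; last exact: compact_box.
by apply: hausdorff_pair; exact: Rhausdorff.
Qed.

End AnnulusChart.

(** * Twists of the annulus acting on cycles *)

Section Twist.
Context (R : realType) (S : topologicalType).
Variable Phi : continuousType (R^o * R^o)%type S.
Hypothesis hS : hausdorff_space S.
Hypothesis Phi_period : forall (a t : R) (k : int), Phi (a + k%:~R, t) = Phi (a, t).
Hypothesis Phi_inj : forall a b t u : R, 0 <= t <= 1 -> 0 <= u <= 1 ->
  Phi (a, t) = Phi (b, u) -> t = u /\ exists k : int, a = b + k%:~R.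
Hypothesis Phi_open : open (Phi @` [set p | 0 < (p.2 : R) < 1]).

Lemma Phi_window (a0 a t : R) : exists b : R,
  a0 <= b <= a0 + 1 /\ Phi (a, t) = Phi (b, t).
Proof.
exists (a - (Num.floor (a - a0))%:~R).
have /andP[] := floor_itv (a - a0); rewrite intrD => h1 h2.
split; first by apply/andP; split; lra.
by rewrite -intrN Phi_period.
Qed.

Lemma closed_Phi_box a b c d : closed (Phi @` box a b c d).
Proof.
apply: compact_closed => //; apply: compact_image; last exact: compact_box.
exact: cts_fun.
Qed.

(** The windows [6^-1] and [5^-1] give variations below 1/3 and 2/5, within the bound 1/2 of
    [is_lift]. *)
Definition good (W : set S) :=
  (forall a t : R, 0 <= t <= 1 -> W (Phi (a, t)) -> t <= 4^-1 \/ 3 / 4 <= t) \/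
  (exists a0 t0 : R, forall y, W y -> exists a t : R,
    [/\ y = Phi (a, t), 0 <= t <= 1, `|a - a0| < 6^-1 & `|t - t0| < 5^-1]).

(** The sets are cut out by removing images of compact boxes, which are closed: the middle annulus
    from [S], or all points far from [p] in angle or height from the open annulus. *)
Lemma good_cover p : exists W, [/\ open W, W p & good W].
Proof.
pose middle := Phi @` box 0 1 4^-1 (3 / 4).
have [[[a0 t0] /= [_ /=]]|nmid] := pselect (middle p); last first.
  exists (~` middle); split=> //; first by apply: closed_openC; exact: closed_Phi_box.
  left=> a t t01 nm; case: (leP t 4^-1) => t4; first by left.
  case: (leP (3 / 4) t) => t3; first by right.
  case: nm; have [b [b01 ->]] := Phi_window 0 a t.
  by exists (b, t) => //; split; rewrite /= in_itv /= ?(ltW t3) ?(ltW t4) //; lra.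
rewrite in_itv /= => t0P pE; pose U := Phi @` [set p | 0 < (p.2 : R) < 1].
pose B := Phi @` box (a0 + 6^-1) (a0 + 5 / 6) 0 1 `|`
  (Phi @` box a0 (a0 + 1) 0 (t0 - 5^-1) `|` Phi @` box a0 (a0 + 1) (t0 + 5^-1) 1).
have clB : closed B by do !apply: closedU; exact: closed_Phi_box.
exists (U `&` ~` B); split.
- by apply: openI => //; exact: closed_openC.
- split; first by exists (a0, t0) => //=; lra.
  have t01 : 0 <= t0 <= 1 by lra.
  move=> [|[|]] [[b u] /= [/= + +]]; rewrite !in_itv /= => bP uP; rewrite -pE.
  + move=> /Phi_inj [|//|ut [k bE]]; first by [].
    suff k0 : k = 0 by move: bE; rewrite k0 addr0 => bE; lra.
    by apply: (@small_intr_eq0 R); rewrite ltr_norml; apply/andP; split; lra.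
  + by move=> /Phi_inj [|//|ut _]; lra.
  + by move=> /Phi_inj [|//|ut _]; lra.
right; exists a0, t0 => y [[[b t] /= t01 yE] nB].
have [a [aP aE]] := Phi_window a0 b t.
have yE' : y = Phi (a, t) by rewrite -aE.
have tP : `|t - t0| < 5^-1.
  rewrite ltNge ler_normr; apply/negP => tt; apply: nB; right.
  case/orP: tt => tt; [right|left]; exists (a, t) => //; split; rewrite /= in_itv /= //; lra.
case: (ltP a (a0 + 6^-1)) => a6.
  by exists a, t; split => //; [lra|rewrite ltr_norml; apply/andP; split; lra].
case: (leP a (a0 + 5 / 6)) => a56.
  by case: nB; left; exists (a, t) => //; split; rewrite /= in_itv /= //; lra.
(* An angle in the last sixth of the turn is close to [a0] after subtracting 1. *)
exists (a - 1), t; split => //; first by rewrite yE' -[RHS](Phi_period _ _ 1) subrK.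
  lra.
by rewrite ltr_norml; apply/andP; split; lra.
Qed.

(** [Phi] is injective on a compact box of angular width 1/3, so its inverse there is continuous and
    gives the lift. *)
Lemma good_simplex n (s : sing R S n) W : good W -> (forall x, W (s x)) ->
  near_boundary Phi s \/ exists th t, is_lift Phi s th t.
Proof.
move=> [gW|[a0 [t0 gW]]] sW; [left|right].
  by move=> x a t t01 sE; apply: (gW a t t01); rewrite -sE.
pose C := box (a0 - 6^-1) (a0 + 6^-1) (0 : R) 1.
have /choice[g gP] x : exists p : R^o * R^o,
    [/\ s x = Phi p, 0 <= (p.2 : R) <= 1, `|p.1 - a0| < 6^-1 & `|p.2 - t0| < 5^-1].
  by have [a [t H]] := gW _ (sW x); exists (a, t).
have cg : continuous g.
  apply: (@continuous_lift _ _ _ Phi C) => //.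
  - exact: cts_fun.
  - exact: compact_box.
  - exact: closed_box.
  - move=> [a t] [b u] /set_mem [/= + +] /set_mem [/= + +]; rewrite !in_itv /=.
    move=> aP tP bP uP /(Phi_inj tP uP) [-> [k aE]].
    suff k0 : k = 0 by rewrite aE k0 addr0.
    by apply: (@small_intr_eq0 R); rewrite ltr_norml; apply/andP; split; lra.
  - move=> x; have [_ tP + _] := gP x; rewrite ltr_norml => aP.
    by split; rewrite /= in_itv //=; lra.
  - rewrite (_ : (fun x => Phi (g x)) = s); first exact: cts_fun.
    by apply/funext => x; have [->] := gP x.
exists (fun x => (g x).1), (fun x => (g x).2); split.
- by split; apply: (continuous_compo cg) => p; [exact: cvg_fst|exact: cvg_snd].
- by move=> x; have [] := gP x.
- by move=> x; have [-> _ _ _] := gP x; case: (g x).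
- move=> x y; have [_ _ + _] := gP x; have [_ _ + _] := gP y.
  by rewrite !ltr_norml => /andP[? ?] /andP[? ?]; apply/andP; split; lra.
- move=> x y; have [_ _ _ +] := gP x; have [_ _ _ +] := gP y.
  by rewrite !ltr_norml => /andP[? ?] /andP[? ?]; apply/andP; split; lra.
Qed.

(** The default [y] gives the identity off the annulus. As [q] depends on the height only, the
    choice of [a] does not matter ([twistE]). *)
Definition twist (q : R -> R) (y : S) : S :=
  xget y [set z | exists a t : R,
    [/\ 0 <= t <= 1, y = Phi (a, t) & z = Phi (a + q t, t)]].

Lemma twistE q (a t : R) : 0 <= t <= 1 -> twist q (Phi (a, t)) = Phi (a + q t, t).
Proof.
move=> t01; apply: xget_unique; first by exists a, t.
move=> z [b [u [u01 yE ->]]]; have [-> [k ->]] := Phi_inj t01 u01 yE.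
by rewrite addrAC Phi_period.
Qed.

Lemma twist_out q y : (forall a t : R, 0 <= t <= 1 -> y <> Phi (a, t)) -> twist q y = y.
Proof.
by move=> yout; apply: xgetPN => z [a [t [t01 yE _]]]; exact: yout t01 yE.
Qed.

Section Homotopy.
Variables (q : R -> R -> R) (k : int).
Hypothesis cq : continuous (fun p : R^o * R^o => q p.1 p.2).
Hypotheses (q0 : forall s, q s 0 = 0) (q1 : forall s, q s 1 = k%:~R).

Let annulus := Phi @` [set p | 0 < (p.2 : R) < 1].

(** On the boundary circles [q] is an integer, so the twist is a deck translation there. *)
Lemma twist_outside s y : ~ annulus y -> twist (q s) y = y.
Proof.
move=> ny; have [[a [t [t01 yE]]]|nE] :=
  pselect (exists a t : R, 0 <= t <= 1 /\ y = Phi (a, t)); last first.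
  by apply: twist_out => a t t01 yE; apply: nE; exists a, t.
rewrite yE twistE //; have [t0|t0] := eqVneq t 0; first by rewrite t0 q0 addr0.
have [->|t1] := eqVneq t 1; first by rewrite q1 Phi_period.
case: ny; exists (a, t) => //=; rewrite !lt_neqAle eq_sym t0 t1 /=.
by move: t01; lra.
Qed.

(* The preimage of a closed set is a union of two closed sets, one over the
   compact closed annulus and one over the complement of the open annulus. *)
Lemma twist_homotopy_continuous :
  continuous (fun p : R^o * S => twist (q (clamp p.1)) p.2).
Proof.
pose cube := `[0 : R, 1]%classic `*` box 0 1 0 1 : set (R^o * (R^o * R^o)).
pose kap (p : R^o * (R^o * R^o)) : R^o * S := (p.1, Phi p.2).
pose h (p : R^o * (R^o * R^o)) : S := Phi (p.2.1 + q p.1 p.2.2, p.2.2).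
have ccube : compact cube.
  by apply: compact_setX; [exact: segment_compact|exact: compact_box].
have hRS : hausdorff_space (R^o * S)%type.
  by apply: hausdorff_pair => //; exact: Rhausdorff.
have clcube : closed cube.
  apply: compact_closed ccube; do 2!(apply: hausdorff_pair; first exact: Rhausdorff).
  exact: Rhausdorff.
have ckap : continuous kap.
  apply: continuous_pair => p; first exact: cvg_fst.
  by apply: (@continuous_snd_compo R^o _ _ Phi); exact: cts_fun.
have c1 : continuous (fun p : R^o * (R^o * R^o) => p.1) by move=> p; exact: cvg_fst.
have c2 : continuous (fun p : R^o * (R^o * R^o) => p.2) by move=> p; exact: cvg_snd.
have c21 : continuous (fun p : R^o * (R^o * R^o) => p.2.1).
  by apply: (continuous_compo c2) => p; exact: cvg_fst.
have c22 : continuous (fun p : R^o * (R^o * R^o) => p.2.2).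
  by apply: (continuous_compo c2) => p; exact: cvg_snd.
have ch : continuous h.
  apply: (@continuous_compo _ _ _ (fun p : R^o * (R^o * R^o) =>
    ((p.2.1 + q p.1 p.2.2 : R^o), (p.2.2 : R^o))) Phi); last exact: cts_fun.
  apply: continuous_pair => //; apply: continuous_add => //.
  apply: (@continuous_compo _ _ _ (fun p : R^o * (R^o * R^o) => (p.1, p.2.2)) _ _ cq).
  exact: continuous_pair.
apply/continuous_closedP => D clD.
have -> : (fun p : R^o * S => twist (q (clamp p.1)) p.2) @^-1` D =
    (fun p : R^o * S => (clamp p.1 : R^o, p.2)) @^-1`
      (kap @` (cube `&` h @^-1` D) `|` snd @^-1` (~` annulus `&` D)).
  apply/seteqP; split=> -[s y] /=.
    have [[[a t] /= t01 <-]|ny] := pselect (annulus y); last first.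
      by rewrite twist_outside // => Dy; right.
    have t01' : 0 <= t <= 1 by lra.
    have [b [bP ->]] := Phi_window 0 a t; rewrite twistE // => Dy.
    left; exists (clamp s, (b, t)) => //; split=> //.
    by split=> /=; rewrite ?in_itv /= ?clampP //; split; rewrite /= in_itv /= ?t01' //; lra.
  move=> [[[u [a t]] /= [[_ [_ /= t01]] Dh] [<- <-]]|[ny Dy]]; last by rewrite twist_outside.
  by rewrite twistE //; move: t01; rewrite in_itv.
apply: closed_preimage.
  apply: continuous_pair; last by move=> p; exact: cvg_snd.
  by apply: continuous_fst_compo; exact: continuous_clamp.
apply: closedU.
  apply: compact_closed => //; apply: compact_image => //.
  by apply: compact_capr => //; exact: closed_preimage.
apply: closed_preimage; first by move=> p; exact: cvg_snd.
by apply: closedI => //; exact: open_closedC.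
Qed.

Definition twist_homotopy : continuousType (R^o * S)%type S :=
  mkcts twist_homotopy_continuous.

End Homotopy.

(** From the [m]-th power of the linear twist at time 0 to a twist that is the identity near the
    boundary circles at time 1. *)
Definition flatten_twist (m : nat) (s t : R) := m%:R * ((1 - s) * t + s * profile t).

Lemma flatten_twist_continuous m :
  continuous (fun p : R^o * R^o => flatten_twist m p.1 p.2).
Proof.
have c1 : continuous (fun p : R^o * R^o => p.1 : R) by move=> p; exact: cvg_fst.
have c2 : continuous (fun p : R^o * R^o => p.2 : R) by move=> p; exact: cvg_snd.
apply: continuous_mul; first exact: cst_continuous.
apply: continuous_add; apply: continuous_mul => //.
  by apply: continuous_sub => //; exact: cst_continuous.
exact: (continuous_compo c2 (@continuous_profile R)).
Qed.

Lemma flatten_twist0 m s : flatten_twist m s 0 = 0.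
Proof. by rewrite /flatten_twist profile0 ?invr_ge0 //; ring. Qed.

Lemma flatten_twist1 m s : flatten_twist m s 1 = m%:Z%:~R.
Proof. rewrite /flatten_twist profile1; last lra. by rewrite -pmulrn; ring. Qed.

Definition flattening m : continuousType (R^o * S)%type S :=
  twist_homotopy (@flatten_twist_continuous m) (@flatten_twist0 m) (@flatten_twist1 m).

Lemma flattened_cycle (z : chain R S 2) : boundary z = 0 ->
  negl root_rate (fun m => push (stage (flattening m) 1) z - z).
Proof.
move=> z0; have r0 m : (0 < root_rate m)%N by [].
have [z' [w [z'0 z'E small]]] := small_simplices good_cover z0.
have fix1 m a t : 0 <= t <= 1 ->
    stage (flattening m) 1 (Phi (a, t)) = Phi (a + m%:R * profile t, t).
  move=> t01; rewrite -[LHS]/(twist _ _) twistE //= clamp1 // /flatten_twist.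
  by congr (Phi (_, _)); ring.
have main : negl root_rate (fun m => push (stage (flattening m) 1) z' - z').
  apply: (@negl_ext _ _ _ _ (fun m => fglift (fun s : sing R S 2 =>
      << stage (flattening m) 1 \o s : sing R S 2 >> - << s >>) z')).
    move=> m; rewrite fglift_sub; congr (_ - _).
    rewrite fgliftE -[LHS]freeg_sumE; apply: eq_bigr => s _; exact: freegUZ.
  apply: (negl_fglift (Psi := correction Phi)) => // s sz.
  have [W gW sW] := small _ sz; have [sb|[th [t st]]] := good_simplex gW sW; last first.
    apply: (twist_negl Phi_period Phi_inj st) => m x; have [_ t01 sE _ _] := st.
    by rewrite /= sE fix1.
  apply: negl_ext (@negl0 _ _ root_rate 2) => m.
  rewrite boundary_sing2 fgliftD fgliftB !fgliftU1.
  rewrite !(correction_near_boundary Phi_period); try by move=> x; exact: sb.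
  rewrite subr0 addr0 subr0.
  apply/eqP; rewrite subr_eq0; apply/eqP; congr << _ >>; apply/continuousEP => x /=.
  have [[a [t [t01 yE]]]|nE] :=
      pselect (exists a t : R, 0 <= t <= 1 /\ s x = Phi (a, t)); last first.
    by apply: twist_out => a t t01 yE; apply: nE; exists a, t.
  rewrite yE fix1 //; have [t4|t4] := sb x a t t01 yE.
    by rewrite profile0 // mulr0 addr0.
  by rewrite profile1 // mulr1 pmulrn Phi_period.
(* Returning from [z'] to [z] costs at most twice [norm1 w], since pushing forward does not increase
   norms. *)
have bnd : negl root_rate (fun m => boundary (push (stage (flattening m) 1) w - w)).
  apply: (@negl_bounded _ _ _ _ r0 (norm1 w + norm1 w)) => m.
  apply: fills_le (fills_boundary _); apply: leq_trans (norm1D _ _) _.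
  by rewrite norm1N leq_add2r norm1_push.
apply: negl_ext (neglB main bnd) => m.
rewrite z'E boundaryB -push_boundary /push !fgliftD; chain_ring.
Qed.

End Twist.

(** * Sublinear growth and the limit *)

Section SublinearLimit.
Context (R : realType).

(** With [r] the integer root of [m], the hypothesis gives [2 j <= r], so
    [j (r + 1) <= r^2 <= m]. *)
Lemma root_rate_le (j m : nat) : (4 * j * j <= m)%N -> (j * root_rate m <= m)%N.
Proof. by have := sqrt_spec m; rewrite /root_rate; nia. Qed.

Lemma root_rate_cvg (K : nat) :
  (m%:R^-1 * (K * root_rate m)%:R : R) @[m --> \oo] --> (0 : R).
Proof.
apply/cvgrPdist_le => e e0 /=.
(* [K < e j], hence [K * root_rate m <= e j * root_rate m <= e m] for large [m]. *)
pose j := (Num.truncn (K%:R / e)).+1.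
have jP : K%:R / e < j%:R := truncnS_gt _.
near=> m; rewrite sub0r normrN ger0_norm ?mulr_ge0 ?invr_ge0 //.
have mj : (4 * j * j <= m)%N by near: m; exact: nbhs_infty_ge.
have m0 : 0 < m%:R :> R by rewrite ltr0n; move: mj; rewrite /j; lia.
rewrite mulrC ler_pdivrMr // natrM.
have jr : j%:R * (root_rate m)%:R <= m%:R :> R.
  by rewrite -natrM ler_nat; exact: root_rate_le.
apply: le_trans (ler_wpM2l (ltW e0) jr); rewrite mulrA ler_wpM2r //.
by rewrite mulrC -ler_pdivrMr // ltW.
Unshelve. all: by end_near. Qed.

Lemma negl_filling_norm (S : topologicalType) n (c : nat -> chain R S n) :
  negl root_rate c ->
  ((m%:R^-1)%:E * filling_norm (c m))%E @[m --> \oo] --> (0 : R)%:E.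
Proof.
move=> [K HK].
apply: (@squeeze_cvge _ _ _ _ (fun=> 0%E) _ (fun m => (m%:R^-1 * (K * root_rate m)%:R)%:E)).
- near=> m; apply/andP; split.
    apply: mule_ge0; first by rewrite lee_fin invr_ge0.
    by apply: le_ereal_inf_tmp => _ [b _ <-]; rewrite lee_fin.
  rewrite EFinM; apply: lee_wpmul2l; first by rewrite lee_fin invr_ge0.
  have [b [bc bK]] := HK m; apply: (@le_trans _ _ (norm1 b)%:R%:E).
    by apply: ereal_inf_lbound; exists b.
  by rewrite lee_fin ler_nat.
- exact: cvg_cst.
- apply: cvg_EFin; [by near=> m|exact: root_rate_cvg].
Unshelve. all: by end_near. Qed.

End SublinearLimit.

(** * Powers of an isotopy and the conclusion *)

Section Isotopy.
Context (R : realType) (S : topologicalType).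
Variable H : unit_interval R * S -> S.
Hypothesis cH : continuous H.

(** Iterating every stage of an isotopy from [T] to [f] joins [T^m] to [f^m]; clamping extends the
    time to the real line. *)
Definition iter_isotopy (m : nat) (p : R^o * S) : S :=
  iter m (fun y => H (unit_of p.1, y)) p.2.

Lemma iter_isotopy_continuous m : continuous (iter_isotopy m).
Proof.
elim: m => [|m IHm]; first by move=> p; exact: cvg_snd.
apply: (@continuous_compo _ _ _ (fun p => (unit_of p.1, iter_isotopy m p)) H) => //.
apply: continuous_pair => //; apply: continuous_fst_compo.
by apply: continuous_unit_of => x; exact: cvg_id.
Qed.

Definition isotopy_power m : continuousType (R^o * S)%type S :=
  mkcts (@iter_isotopy_continuous m).

End Isotopy.

Theorem theorem3p4 (R : realType) (S : topologicalType)
    (o : orientation R 1 S) (g : nat)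
    (gamma : circle R -> S) (f : continuousType S S) :
  closed_manifold R 2 S -> connected [set: S]%classic ->
  (1 <= g)%N -> has_genus R S g ->
  simple_closed_curve gamma -> dehn_twist gamma f ->
  integral_filling_volume_eq o f 0%R.
Proof.
move=> [hS _ _ _] _ _ _ _ [T [[phi [[cphi iphi ophi _] Tphi Tout]] [H [cH _ H0 H1]]]].
move=> z [z0 _]; apply: negl_filling_norm.
have r0 m : (0 < root_rate m)%N by [].
pose Phi := chart cphi.
have per : forall (a t : R) (k : int), Phi (a + k%:~R, t) = Phi (a, t) := chart_period cphi.
have inj := @chart_inj _ _ _ cphi iphi.
have oPhi : open (Phi @` [set p | 0 < (p.2 : R) < 1]).
  rewrite (_ : _ @` _ = phi @` [set p | 0 < val p.2 < 1]) //.
  apply/seteqP; split=> y [[a t] /= t01 <-].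
    exists (cis (2 * pi * a), unit_of t) => //=.
    by rewrite clamp_id // !ltW //; move: t01 => /andP[].
  have [b [u [u01 E]]] := chart_surj cphi (a, t); rewrite E.
  exists (b, u) => //=; move: E => /iphi E.
  by have := congr1 (fun p => val p.2) E; rewrite /= clamp_id // => <-.
(* With angles in full turns, the rotation by [2 pi t] is the translation by [t]. *)
have TPhi a t : 0 <= t <= 1 -> T (Phi (a, t)) = Phi (a + t, t).
  move=> t01; rewrite -[LHS]/(T (phi (_, _))) Tphi; congr (phi (cis _, _)).
  by rewrite /= clamp_id //; ring.
have iterT m y : iter m T y = twist Phi (fun t => m%:R * t) y.
  have [[a [t [t01 ->]]]|nE] :=
      pselect (exists a t : R, 0 <= t <= 1 /\ y = Phi (a, t)); last first.
    rewrite twist_out; last by move=> a t t01 yE; apply: nE; exists a, t.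
    elim: m => //= m ->; apply: Tout => -[p _ pE]; apply: nE.
    by have [a [t [t01 E]]] := chart_surj cphi p; exists a, t; rewrite -pE.
  rewrite twistE //; elim: m => [|m IHm] /=; first by rewrite mul0r addr0.
  by rewrite IHm TPhi // -natr1 mulrDl mul1r addrA.
(* Both homotopies start at [T^m]; the first ends at [f^m], the second at the flattened twist, so
   [N1 - N2 + N3] telescopes to the chain to be filled. *)
have N1 := push_homotopic r0 (isotopy_power cH) z0.
have N2 := push_homotopic r0 (flattening hS per inj oPhi) z0.
have N3 := flattened_cycle hS per inj oPhi z0.
have E0 m : stage (isotopy_power cH m) 0 = stage (flattening hS per inj oPhi m) 0.
  apply/continuousEP => y; rewrite -[LHS]/(iter m _ y) -[RHS]/(twist _ _ y).
  rewrite (_ : (fun y => _) = T); last first.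
    by apply/funext => x; apply: H0; rewrite /= clamp0.
  rewrite iterT; congr (twist _ _ _); apply/funext => t.
  by rewrite clamp0 // /flatten_twist; ring.
have E1 m : stage (isotopy_power cH m) 1 = iterate f m.
  apply/continuousEP => y; rewrite -[LHS]/(iter m _ y) -[RHS]/(iter m f y).
  congr (iter m _ y).
  by apply/funext => x; apply: H1; rewrite /= clamp1.
apply: negl_ext (neglD (neglB N1 N2) N3) => m.
rewrite -E1 -E0; chain_ring.
Qed.
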